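(* Let $a\in\mathbb{R}\setminus\{0\}$ and let $\gamma_0(t)=(\cos t,\sin t)$ be the unit circle. For $a<0$, the circle $\gamma_0$ is a local minimum of $\mathcal{B}_a$; for $a\in(0,\tfrac13)$, it is a local maximum; for $a>\tfrac75$, it is a local minimum; and in other cases the Hessian is not sign-definite. The Hessian is degenerate (with 1-dimensional kernel) if and only if $a=\frac{k^2-2}{k^2-4}$ for some positive integer $k$.
   Context: $[\cdot,\cdot]$ denotes the determinant of two vectors in $\mathbb{R}^2$. Consider smooth $2\pi$-periodic curves $\gamma:\mathbb{R}\to\mathbb{R}^2$ in centroaffine parameterization, i.e. with $[\gamma,\gamma']=1$, and with centroaffine curvature $p=[\gamma',\gamma'']>0$ (so $\gamma''=-p\gamma$). On this space of curves, $\mathcal{B}_a(\gamma)=\int_0^{2\pi}p(t)^a\,dt$. The unit circle $\gamma_0$ is a critical curve of $\mathcal{B}_a$ for every $a$. For a second order deformation $\gamma_0+\varepsilon\gamma_1+\varepsilon^2\gamma_2$ of $\gamma_0$ in this space one has $\gamma_1=-\tfrac{f'}{2}\gamma_0+f\gamma_0'$ with $f$ a $2\pi$-periodic function, and the Hessian of $\mathcal{B}_a$ at $\gamma_0$ is the quadratic form in $f$ given by the $\varepsilon^2$-coefficient of $\mathcal{B}_a$. The functional $\mathcal{B}_a$ is invariant under the action of $SL(2,\mathbb{R})$ on curves; the corresponding infinitesimal deformations, $f\in\mathrm{span}(1,\cos 2t,\sin 2t)$, are regarded as trivial, and the statements are understood modulo them.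
   Formalization: The kernel modulo trivial deformations is span(cos kt, sin kt), of real dimension 2, so ''1-dimensional'' is stated as a complex line in the Fourier coordinates (c_n ↦ i c_n); k = 2, where the formula for a is undefined, is excluded. *)

(* Defs.v *)
From Stdlib Require Import Reals.
From Coquelicot Require Import Coquelicot.
Open Scope R_scope.

Definition det (u v : R * R) : R := fst u * snd v - snd u * fst v.

Definition smooth (f : R -> R) : Prop := forall n t, ex_derive_n f n t.

Definition periodic {T : Type} (f : R -> T) : Prop :=
  forall t, f (t + 2 * PI) = f t.

Definition curve : Type := R -> R * R.

Definition smooth_curve (g : curve) : Prop :=
  smooth (fun t => fst (g t)) /\ smooth (fun t => snd (g t)).

Definition Dcurve (n : nat) (g : curve) : curve := fun t =>
  (Derive_n (fun s => fst (g s)) n t, Derive_n (fun s => snd (g s)) n t).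

Definition centroaffine_curvature (g : curve) (t : R) : R :=
  det (Dcurve 1 g t) (Dcurve 2 g t).

Definition curve_space (g : curve) : Prop :=
  smooth_curve g /\ periodic g /\
  (forall t, det (g t) (Dcurve 1 g t) = 1) /\
  (forall t, 0 < centroaffine_curvature g t).

Definition calB (a : R) (g : curve) : R :=
  RInt (fun t => Rpower (centroaffine_curvature g t) a) 0 (2 * PI).

Definition circle : curve := fun t => (cos t, sin t).

(* The sets [Cr_close r delta g0] form a neighbourhood basis of [g0] for the
   C^infinity topology on periodic smooth curves. *)
Definition Cr_close (r : nat) (delta : R) (g0 g : curve) : Prop :=
  forall j t, (j <= r)%nat ->
    Rabs (fst (Dcurve j g t) - fst (Dcurve j g0 t)) < delta /\
    Rabs (snd (Dcurve j g t) - snd (Dcurve j g0 t)) < delta.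

Definition local_min (F : curve -> R) (g0 : curve) : Prop :=
  exists (r : nat) (delta : R), 0 < delta /\
    forall g, curve_space g -> Cr_close r delta g0 g -> F g0 <= F g.

Definition local_max (F : curve -> R) (g0 : curve) : Prop :=
  local_min (fun g => - F g) g0.

Definition admissible (f : R -> R) : Prop := smooth f /\ periodic f.

Definition add_curve (g h : curve) : curve := fun t =>
  (fst (g t) + fst (h t), snd (g t) + snd (h t)).

Definition scale_curve (c : R -> R) (g : curve) : curve := fun t =>
  (c t * fst (g t), c t * snd (g t)).

Definition gamma1 (f : R -> R) : curve :=
  add_curve (scale_curve (fun t => - (Derive f t / 2)) circle)
            (scale_curve f (Dcurve 1 circle)).

Definition deformation (g1 g2 : curve) (eps : R) : curve :=
  add_curve circle
    (add_curve (scale_curve (fun _ => eps) g1)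
               (scale_curve (fun _ => eps ^ 2) g2)).

(* The two equations are the vanishing of the coefficients of eps and eps^2 in
   [g, g'] - 1, where g = deformation g1 g2 eps. *)
Definition second_order_deformation (g1 g2 : curve) : Prop :=
  smooth_curve g1 /\ periodic g1 /\ smooth_curve g2 /\ periodic g2 /\
  (forall t, det (circle t) (Dcurve 1 g1 t) +
             det (g1 t) (Dcurve 1 circle t) = 0) /\
  (forall t, det (circle t) (Dcurve 1 g2 t) + det (g1 t) (Dcurve 1 g1 t) +
             det (g2 t) (Dcurve 1 circle t) = 0).

(* b eps = c0 + c1 eps + q eps^2 + o(eps^2) as eps tends to 0. *)
Definition is_eps2_coefficient (b : R -> R) (q : R) : Prop :=
  exists c0 c1 : R,
    is_lim (fun eps => (b eps - c0 - c1 * eps) / eps ^ 2) 0 q.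

(* Independence of the choice of g2 is part of the definition; since some g2
   exists, Q is determined on all admissible f. *)
Definition is_hessian (a : R) (Q : (R -> R) -> R) : Prop :=
  forall f, admissible f ->
    (exists g2, second_order_deformation (gamma1 f) g2) /\
    (forall g2, second_order_deformation (gamma1 f) g2 ->
       is_eps2_coefficient
         (fun eps => calB a (deformation (gamma1 f) g2 eps)) (Q f)).

Definition trivial_deformation (f : R -> R) : Prop :=
  exists c0 c1 c2 : R, forall t,
    f t = c0 + c1 * cos (2 * t) + c2 * sin (2 * t).

Definition positive_definite (Q : (R -> R) -> R) : Prop :=
  forall f, admissible f -> ~ trivial_deformation f -> 0 < Q f.

Definition negative_definite (Q : (R -> R) -> R) : Prop :=
  forall f, admissible f -> ~ trivial_deformation f -> Q f < 0.

Definition sign_definite (Q : (R -> R) -> R) : Prop :=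
  positive_definite Q \/ negative_definite Q.

(* The radical of the polar form Q (f + g) - Q f - Q g. *)
Definition in_kernel (Q : (R -> R) -> R) (f : R -> R) : Prop :=
  admissible f /\
  forall g, admissible g -> Q (fun t => f t + g t) - Q f - Q g = 0.

Definition degenerate (Q : (R -> R) -> R) : Prop :=
  exists f, in_kernel Q f /\ ~ trivial_deformation f.

Definition cos_coef (f : R -> R) (n : nat) : R :=
  RInt (fun t => f t * cos (INR n * t)) 0 (2 * PI) / PI.

Definition sin_coef (f : R -> R) (n : nat) : R :=
  RInt (fun t => f t * sin (INR n * t)) 0 (2 * PI) / PI.

(* Writing f = c_0 + Re (sum_(n >= 1) c_n e^(i n t)), with
   c_n = cos_coef f n - i sin_coef f n for n >= 1, the function g is a
   representative of i f: its coefficients are i c_n for every n >= 1.  This is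
   a complex structure on the admissible functions modulo the trivial ones. *)
Definition times_i (f g : R -> R) : Prop :=
  forall n, (1 <= n)%nat ->
    cos_coef g n = sin_coef f n /\ sin_coef g n = - cos_coef f n.

(* Modulo trivial deformations, the kernel is the complex line spanned by f0:
   its elements are the (x + i y) f0 with x, y real.  Each frequency n
   contributes one complex coordinate c_n, that is both cos (n t) and
   sin (n t); over the real numbers the dimension is 2. *)
Definition one_dimensional_kernel (Q : (R -> R) -> R) : Prop :=
  exists f0 if0 : R -> R,
    admissible f0 /\ ~ trivial_deformation f0 /\
    admissible if0 /\ times_i f0 if0 /\
    forall f, admissible f ->
      (in_kernel Q f <->
       exists x y : R,
         trivial_deformation (fun t => f t - (x * f0 t + y * if0 t))).

(* Main.v *)
Require Import Defs.
From Stdlib Require Import Reals List Lra Lia Classical FunctionalExtensionality.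
From Coquelicot Require Import Coquelicot.
Import ListNotations.
Open Scope R_scope.

(** The curvature [p = 1 + q] does not change under [SL(2)], so a curve near the circle may be
    moved to start like the circle.  In the moving frame of the circle the curve and its
    derivative then have coordinates [(1 + N, T)] and [(A, 1 + B)], and Gronwall's inequality
    bounds the displacement [(N, T, A, B)] by the [L^2] norm of [q].  Up to terms of higher order
    [q = - (N'' + 4 N)] and [int q = int (N'' + 4 N) N].  The Fourier symbol of [N'' + 4 N] is
    [4 - n^2], and [(4 - n^2) (1 - n^2) >= 0], [(4 - n^2) (9 - n^2) >= 0] for every integer [n],
    so [int q] lies between [- 1/5 int q^2] and [1/3 int q^2], asymptotically.  Inserting this in
    [int (1 + q)^a = 2 pi + a int q + a (a - 1) / 2 int q^2 + ...] gives the local extrema.  The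
    Hessian is given by a self-adjoint differential operator which is diagonal in the Fourier
    basis, with eigenvalue [a n^2 (n^2 - 4) ((a - 1) (n^2 - 4) - 2) / 8] at frequency [n]. *)

(** * Smooth periodic functions *)

Definition cont (f : R -> R) : Prop := forall t, continuous f t.

Lemma smooth_coind (P : (R -> R) -> Prop) :
  (forall f, P f -> (forall t, ex_derive f t) /\ P (Derive f)) ->
  forall f, P f -> smooth f.
Proof.
  intros HP f Hf.
  assert (HD : forall n, P (Derive_n f n)).
  { induction n as [|n IH]; [exact Hf|]. exact (proj2 (HP _ IH)). }
  intros [|n] t; [exact I|]. exact (proj1 (HP _ (HD n)) t).
Qed.

Lemma smooth_ex_derive f t : smooth f -> ex_derive f t.
Proof. intros Hf. exact (Hf 1%nat t). Qed.

Lemma smooth_Derive f : smooth f -> smooth (Derive f).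
Proof.
  intros Hf. apply (smooth_coind (fun g => exists n, g = Derive_n f n)).
  - intros g [n ->]. split; [exact (Hf (S n))|]. now exists (S n).
  - now exists 1%nat.
Qed.

Lemma smooth_cont f : smooth f -> cont f.
Proof.
  intros Hf t. apply (ex_derive_continuous (V := R_NormedModule)).
  now apply smooth_ex_derive.
Qed.

Lemma Derive_plus_fun f g : (forall t, ex_derive f t) -> (forall t, ex_derive g t) ->
  Derive (fun t => f t + g t) = fun t => Derive f t + Derive g t.
Proof.
  intros Df Dg. apply functional_extensionality; intros t. now apply Derive_plus.
Qed.

Lemma Derive_mult_fun f g : (forall t, ex_derive f t) -> (forall t, ex_derive g t) ->
  Derive (fun t => f t * g t) = fun t => Derive f t * g t + f t * Derive g t.
Proof.
  intros Df Dg. apply functional_extensionality; intros t. now apply Derive_mult.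
Qed.

(* Differentiating a product gives a sum of products, so coinduction needs sums and products
   at once. *)
Inductive smooth_algebra : (R -> R) -> Prop :=
| smooth_algebra_gen f : smooth f -> smooth_algebra f
| smooth_algebra_plus f g :
    smooth_algebra f -> smooth_algebra g -> smooth_algebra (fun t => f t + g t)
| smooth_algebra_mult f g :
    smooth_algebra f -> smooth_algebra g -> smooth_algebra (fun t => f t * g t).

Lemma smooth_algebra_Derive f :
  smooth_algebra f -> (forall t, ex_derive f t) /\ smooth_algebra (Derive f).
Proof.
  induction 1 as [f Hf|f g Hf [Df IHf] Hg [Dg IHg]|f g Hf [Df IHf] Hg [Dg IHg]].
  - split; [intros t; now apply smooth_ex_derive|].
    now apply smooth_algebra_gen, smooth_Derive.
  - split; [intros t; now apply (ex_derive_plus (V := R_NormedModule))|].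
    rewrite Derive_plus_fun by easy. now apply smooth_algebra_plus.
  - split; [intros t; now apply ex_derive_mult|].
    rewrite Derive_mult_fun by easy. now apply smooth_algebra_plus; apply smooth_algebra_mult.
Qed.

Lemma smooth_plus f g : smooth f -> smooth g -> smooth (fun t => f t + g t).
Proof.
  intros Hf Hg. apply (smooth_coind smooth_algebra smooth_algebra_Derive).
  now apply smooth_algebra_plus; apply smooth_algebra_gen.
Qed.

Lemma smooth_mult f g : smooth f -> smooth g -> smooth (fun t => f t * g t).
Proof.
  intros Hf Hg. apply (smooth_coind smooth_algebra smooth_algebra_Derive).
  now apply smooth_algebra_mult; apply smooth_algebra_gen.
Qed.

Lemma smooth_const c : smooth (fun _ => c).
Proof.
  apply (smooth_coind (fun f => exists b, f = fun _ => b)); [|now exists c].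
  intros f [b ->]. split; [intros t; apply ex_derive_const|]. exists 0.
  apply functional_extensionality; intros t. apply Derive_const.
Qed.

Lemma smooth_opp f : smooth f -> smooth (fun t => - f t).
Proof.
  intros Hf. replace (fun t => - f t) with (fun t => -1 * f t).
  - apply smooth_mult; [apply smooth_const|exact Hf].
  - apply functional_extensionality; intros t; ring.
Qed.

Lemma smooth_minus f g : smooth f -> smooth g -> smooth (fun t => f t - g t).
Proof. intros Hf Hg. apply smooth_plus; [exact Hf|now apply smooth_opp]. Qed.

Lemma cont_plus f g : cont f -> cont g -> cont (fun t => f t + g t).
Proof. intros Hf Hg t. now apply (continuous_plus (V := R_NormedModule)). Qed.

Lemma cont_opp f : cont f -> cont (fun t => - f t).
Proof. intros Hf t. now apply (continuous_opp (V := R_NormedModule)). Qed.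

Lemma cont_minus f g : cont f -> cont g -> cont (fun t => f t - g t).
Proof. intros Hf Hg t. now apply (continuous_minus (V := R_NormedModule)). Qed.

Lemma cont_mult f g : cont f -> cont g -> cont (fun t => f t * g t).
Proof. intros Hf Hg t. now apply (continuous_mult (K := R_AbsRing)). Qed.

Lemma cont_const c : cont (fun _ => c).
Proof. intros t. apply continuous_const. Qed.

Lemma cont_pow f n : cont f -> cont (fun t => f t ^ n).
Proof.
  intros Hf; induction n as [|n IH]; simpl; [apply cont_const|now apply cont_mult].
Qed.

Lemma cont_abs f : cont f -> cont (fun t => Rabs (f t)).
Proof.
  intros Hf t. apply (continuous_comp f Rabs); [apply Hf|apply continuous_Rabs].
Qed.

Lemma cont_Rpower p a : cont p -> (forall t, 0 < p t) -> cont (fun t => Rpower (p t) a).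
Proof.
  intros Cp Hp t. apply (continuous_comp p (fun y => Rpower y a)); [apply Cp|].
  apply (ex_derive_continuous (V := R_NormedModule)). eexists.
  apply is_derive_Reals, derivable_pt_lim_power, Hp.
Qed.

Lemma periodic_Derive f : periodic f -> periodic (Derive f).
Proof.
  intros Pf t. unfold Derive. apply f_equal, Lim_ext. intros h.
  replace (t + 2 * PI + h) with (t + h + 2 * PI) by ring. now rewrite !Pf.
Qed.

Lemma admissible_smooth f : admissible f -> smooth f.
Proof. now intros [Sf _]. Qed.

Lemma admissible_periodic f : admissible f -> periodic f.
Proof. now intros [_ Pf]. Qed.

Lemma admissible_ex_derive f t : admissible f -> ex_derive f t.
Proof. intros [Sf _]. now apply smooth_ex_derive. Qed.

Lemma admissible_Derive f : admissible f -> admissible (Derive f).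
Proof. intros [Sf Pf]. split; [now apply smooth_Derive|now apply periodic_Derive]. Qed.

Lemma admissible_plus f g :
  admissible f -> admissible g -> admissible (fun t => f t + g t).
Proof.
  intros [Sf Pf] [Sg Pg]. split; [now apply smooth_plus|].
  intros t. now rewrite Pf, Pg.
Qed.

Lemma admissible_mult f g :
  admissible f -> admissible g -> admissible (fun t => f t * g t).
Proof.
  intros [Sf Pf] [Sg Pg]. split; [now apply smooth_mult|].
  intros t. now rewrite Pf, Pg.
Qed.

Lemma admissible_const c : admissible (fun _ => c).
Proof. split; [apply smooth_const|easy]. Qed.

Lemma admissible_opp f : admissible f -> admissible (fun t => - f t).
Proof.
  intros [Sf Pf]. split; [now apply smooth_opp|]. intros t. now rewrite Pf.
Qed.

Lemma admissible_minus f g :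
  admissible f -> admissible g -> admissible (fun t => f t - g t).
Proof. intros Hf Hg. apply admissible_plus; [exact Hf|now apply admissible_opp]. Qed.

Lemma admissible_div f c : admissible f -> admissible (fun t => f t / c).
Proof. intros Hf. apply admissible_mult; [exact Hf|apply admissible_const]. Qed.

Definition trig (w x y t : R) : R := x * cos (w * t) + y * sin (w * t).

Lemma is_derive_trig w x y t :
  is_derive (trig w x y) t (trig w (w * y) (- w * x) t).
Proof. unfold trig. auto_derive; [easy|ring]. Qed.

Lemma Derive_trig w x y : Derive (trig w x y) = trig w (w * y) (- w * x).
Proof.
  apply functional_extensionality; intros t.
  apply is_derive_unique, is_derive_trig.
Qed.

Lemma smooth_trig w x y : smooth (trig w x y).
Proof.
  apply (smooth_coind (fun f => exists x' y', f = trig w x' y')).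
  - intros f (x' & y' & ->). split.
    + intros t. eexists. apply is_derive_trig.
    + rewrite Derive_trig. now do 2 eexists.
  - now do 2 eexists.
Qed.

Lemma admissible_trig (n : nat) x y : admissible (trig (INR n) x y).
Proof.
  split; [apply smooth_trig|]. intros t. unfold trig.
  replace (INR n * (t + 2 * PI)) with (INR n * t + 2 * INR n * PI) by ring.
  now rewrite cos_period, sin_period.
Qed.

Lemma admissible_cos_mult (n : nat) : admissible (fun t => cos (INR n * t)).
Proof.
  replace (fun t => cos (INR n * t)) with (trig (INR n) 1 0); [apply admissible_trig|].
  apply functional_extensionality; intros t; unfold trig; ring.
Qed.

Lemma admissible_sin_mult (n : nat) : admissible (fun t => sin (INR n * t)).
Proof.
  replace (fun t => sin (INR n * t)) with (trig (INR n) 0 1); [apply admissible_trig|].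
  apply functional_extensionality; intros t; unfold trig; ring.
Qed.

Lemma admissible_cos : admissible cos.
Proof.
  replace cos with (fun t => cos (INR 1 * t)); [apply admissible_cos_mult|].
  apply functional_extensionality; intros t; f_equal; simpl; ring.
Qed.

Lemma admissible_sin : admissible sin.
Proof.
  replace sin with (fun t => sin (INR 1 * t)); [apply admissible_sin_mult|].
  apply functional_extensionality; intros t; f_equal; simpl; ring.
Qed.

Create HintDb regularity.
#[export] Hint Resolve cont_plus cont_opp cont_minus cont_mult cont_const cont_pow
  cont_abs smooth_cont smooth_Derive smooth_plus smooth_mult smooth_const smooth_opp
  smooth_minus admissible_smooth admissible_Derive
  admissible_plus admissible_mult admissible_const admissible_opp admissible_minus
  admissible_div admissible_trig admissible_cos_mult admissible_sin_mult
  admissible_cos admissible_sin : regularity.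

Ltac regular := auto 12 with regularity.

(** * Integration over the circle *)

Lemma twopi_pos : 0 < 2 * PI.
Proof. generalize PI_RGT_0; lra. Qed.

Lemma periodic_IZR (f : R -> R) (k : Z) t : periodic f -> f (t + IZR k * (2 * PI)) = f t.
Proof.
  intros Pf. revert t. induction k as [|k IH|k IH] using Z.peano_ind; intros t.
  - f_equal; ring.
  - rewrite succ_IZR, Rmult_plus_distr_r, Rmult_1_l, <- Rplus_assoc, Pf. apply IH.
  - rewrite <- (IH t), <- Pf. f_equal. rewrite <- Z.sub_1_r, minus_IZR. ring.
Qed.

Lemma periodic_representative t :
  exists s, 0 <= s < 2 * PI /\ forall f : R -> R, periodic f -> f t = f s.
Proof.
  assert (Hpi := twopi_pos).
  destruct (base_Int_part (t / (2 * PI))) as [Hle Hgt].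
  set (k := Int_part (t / (2 * PI))) in *.
  assert (Ht : t = t / (2 * PI) * (2 * PI)) by (field; lra).
  exists (t + IZR (- k) * (2 * PI)). split.
  - rewrite opp_IZR. nra.
  - intros f Pf. now rewrite periodic_IZR.
Qed.

Lemma periodic_le f c : cont f -> periodic f ->
  (forall t, 0 < t < 2 * PI -> f t <= c) -> forall t, f t <= c.
Proof.
  intros Cf Pf Hin t. destruct (periodic_representative t) as (s & Hs & Hts).
  rewrite (Hts f Pf). destruct (Req_dec s 0) as [->|Hne]; [|apply Hin; lra].
  apply Rnot_lt_le. intros Hlt.
  destruct (Cf 0 _ (open_gt c (f 0) Hlt)) as [d Hd].
  assert (Hdp := cond_pos d). set (x := Rmin (d / 2) PI).
  assert (Hx : 0 < x < d /\ x < 2 * PI).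
  { unfold x, Rmin. destruct (Rle_dec _ _); lra. }
  assert (Hball : Rabs (x - 0) < d) by (rewrite Rminus_0_r, Rabs_pos_eq; lra).
  apply (Rlt_not_le _ _ (Hd x Hball)), Hin. lra.
Qed.

Lemma periodic_bounded f : cont f -> periodic f -> exists B, forall t, Rabs (f t) <= B.
Proof.
  intros Cf Pf. assert (Hpi := twopi_pos).
  destruct (continuity_ab_maj (fun t => Rabs (f t)) 0 (2 * PI)) as (M & HM & _); [lra| |].
  - intros s _. apply continuity_pt_filterlim. now apply cont_abs.
  - exists (Rabs (f M)). intros t. destruct (periodic_representative t) as (s & Hs & Hts).
    rewrite (Hts f Pf). apply HM. lra.
Qed.

Lemma admissible_uniformly_bounded (fs : list (R -> R)) :
  (forall f, In f fs -> admissible f) ->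
  exists B, 0 < B /\ forall f t, In f fs -> Rabs (f t) <= B.
Proof.
  induction fs as [|f fs IH]; intros Hfs.
  - exists 1. split; [lra|easy].
  - destruct IH as (B & HB & Hbound); [intros g Hg; apply Hfs; now right|].
    assert (Hf : admissible f) by (apply Hfs; now left).
    destruct (periodic_bounded f) as [b Hb]; [regular|apply Hf|].
    exists (Rmax b B). split; [apply Rlt_le_trans with (1 := HB), Rmax_r|].
    intros g t [<-|Hg].
    + apply Rle_trans with (1 := Hb t), Rmax_l.
    + apply Rle_trans with (1 := Hbound g t Hg), Rmax_r.
Qed.

Definition circint (f : R -> R) : R := RInt f 0 (2 * PI).

Lemma cont_ex_RInt f a b : cont f -> ex_RInt f a b.
Proof.
  intros Hf. apply (ex_RInt_continuous (V := R_CompleteNormedModule)). intros; apply Hf.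
Qed.

Lemma circint_ext_in f g :
  (forall t, 0 < t < 2 * PI -> f t = g t) -> circint f = circint g.
Proof.
  intros Hfg. apply RInt_ext.
  rewrite Rmin_left, Rmax_right by (generalize twopi_pos; lra). exact Hfg.
Qed.

Lemma circint_ext f g : (forall t, f t = g t) -> circint f = circint g.
Proof. intros Hfg. apply circint_ext_in. auto. Qed.

Lemma circint_plus f g : cont f -> cont g ->
  circint (fun t => f t + g t) = circint f + circint g.
Proof.
  intros Hf Hg. apply (RInt_plus (V := R_CompleteNormedModule)); now apply cont_ex_RInt.
Qed.

Lemma circint_minus f g : cont f -> cont g ->
  circint (fun t => f t - g t) = circint f - circint g.
Proof.
  intros Hf Hg. apply (RInt_minus (V := R_CompleteNormedModule)); now apply cont_ex_RInt.
Qed.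

Lemma circint_scal c f : cont f -> circint (fun t => c * f t) = c * circint f.
Proof.
  intros Hf. apply (RInt_scal (V := R_CompleteNormedModule)). now apply cont_ex_RInt.
Qed.

Lemma circint_opp f : cont f -> circint (fun t => - f t) = - circint f.
Proof.
  intros Hf. apply (RInt_opp (V := R_CompleteNormedModule)). now apply cont_ex_RInt.
Qed.

Lemma circint_const c : circint (fun _ => c) = 2 * PI * c.
Proof. unfold circint. rewrite RInt_const. change (scal ?x ?y) with (x * y). ring. Qed.

Lemma circint_le f g : cont f -> cont g ->
  (forall t, 0 < t < 2 * PI -> f t <= g t) -> circint f <= circint g.
Proof.
  intros Hf Hg Hfg. apply RInt_le; try (now apply cont_ex_RInt); [|exact Hfg].
  apply Rlt_le, twopi_pos.
Qed.

Lemma circint_ge0 f : cont f -> (forall t, 0 <= f t) -> 0 <= circint f.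
Proof.
  intros Hf Hpos. replace 0 with (circint (fun _ => 0)) by (rewrite circint_const; ring).
  apply circint_le; regular.
Qed.

Lemma circint_abs_le f g : cont f -> cont g ->
  (forall t, 0 < t < 2 * PI -> Rabs (f t) <= g t) -> Rabs (circint f) <= circint g.
Proof.
  intros Hf Hg Hfg. apply Rabs_le.
  rewrite <- circint_opp by easy.
  split; apply circint_le; regular; intros t Ht;
    generalize (proj1 (Rabs_le_between _ _) (Hfg t Ht)); lra.
Qed.

Lemma circint_Derive f : admissible f -> circint (Derive f) = 0.
Proof.
  intros Hf. unfold circint. rewrite RInt_Derive.
  - rewrite <- (Rplus_0_l (2 * PI)), (admissible_periodic f Hf 0). ring.
  - intros; now apply admissible_ex_derive.
  - intros t _. now apply smooth_cont, smooth_Derive, admissible_smooth.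
Qed.

Lemma circint_parts f g : admissible f -> admissible g ->
  circint (fun t => Derive f t * g t) = - circint (fun t => f t * Derive g t).
Proof.
  intros Hf Hg.
  assert (Hfg := circint_Derive (fun t => f t * g t) ltac:(regular)).
  rewrite (circint_ext _ (fun t => Derive f t * g t + f t * Derive g t)) in Hfg
    by (intros t; apply Derive_mult; now apply admissible_ex_derive).
  rewrite circint_plus in Hfg by regular. lra.
Qed.

Lemma circint_Derive_Derive f g : admissible f -> admissible g ->
  circint (fun t => Derive (Derive f) t * g t)
  = circint (fun t => f t * Derive (Derive g) t).
Proof.
  intros Hf Hg. rewrite !circint_parts by regular. ring.
Qed.

(** * Fourier series *)

Lemma circint_trig n x y : (1 <= n)%nat -> circint (trig (INR n) x y) = 0.
Proof.
  intros Hn. assert (Hn0 : INR n <> 0) by (apply not_0_INR; lia).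
  rewrite (circint_ext _ (fun t => Derive (trig (INR n) (- (y / INR n)) (x / INR n)) t)).
  - apply circint_Derive, admissible_trig.
  - intros t. rewrite Derive_trig. unfold trig. now field.
Qed.

Lemma cos_shiftE w s t : cos (w * (t - s)) = trig w (cos (w * s)) (sin (w * s)) t.
Proof. unfold trig. rewrite Rmult_minus_distr_l, cos_minus; ring. Qed.

Lemma cont_cos_shift w s : cont (fun t => cos (w * (t - s))).
Proof.
  intros t. apply (ex_derive_continuous (V := R_NormedModule)). auto_derive; easy.
Qed.

Lemma cont_sin_shift w s : cont (fun t => sin (w * (t - s))).
Proof.
  intros t. apply (ex_derive_continuous (V := R_NormedModule)). auto_derive; easy.
Qed.

#[export] Hint Resolve cont_cos_shift cont_sin_shift : regularity.

Lemma circint_cos_shift n s : (1 <= n)%nat -> circint (fun t => cos (INR n * (t - s))) = 0.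
Proof.
  intros Hn. rewrite <- (circint_trig n (cos (INR n * s)) (sin (INR n * s)) Hn).
  apply circint_ext. intros t. apply cos_shiftE.
Qed.

Lemma circint_mult_trig f n x y : cont f ->
  circint (fun t => f t * trig (INR n) x y t) = PI * (x * cos_coef f n + y * sin_coef f n).
Proof.
  intros Cf. assert (Hpi := PI_RGT_0).
  rewrite (circint_ext _ (fun t => x * (f t * cos (INR n * t)) + y * (f t * sin (INR n * t))))
    by (intros; unfold trig; ring).
  rewrite circint_plus, !circint_scal by regular.
  unfold cos_coef, sin_coef. fold (circint (fun t => f t * cos (INR n * t))).
  fold (circint (fun t => f t * sin (INR n * t))). field. lra.
Qed.

Lemma cos_coef_0 f : cos_coef f 0 = circint f / PI.
Proof.
  unfold cos_coef. f_equal. apply circint_ext. intros t. simpl.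
  rewrite Rmult_0_l, cos_0; ring.
Qed.

Lemma coef_eq_of_pairing f g c n : cont f -> cont g ->
  (forall x y, circint (fun t => f t * trig (INR n) x y t)
               = c * circint (fun t => g t * trig (INR n) x y t)) ->
  cos_coef f n = c * cos_coef g n /\ sin_coef f n = c * sin_coef g n.
Proof.
  intros Cf Cg Hfg. assert (Hpi := PI_RGT_0).
  assert (Hc := Hfg 1 0). assert (Hs := Hfg 0 1). rewrite !circint_mult_trig in Hc, Hs by easy.
  split; apply (Rmult_eq_reg_l PI); lra.
Qed.

Section OrthogonalSystem.
Variables (phi : nat -> R -> R) (w : R).
Hypothesis norm_pos : 0 < w.
Hypothesis phi_cont : forall k, cont (phi k).
Hypothesis phi_norm : forall k, circint (fun t => phi k t * phi k t) = w.
Hypothesis phi_orthogonal :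
  forall k m, (k < m)%nat -> circint (fun t => phi k t * phi m t) = 0.

Lemma orthogonal_projection k G : cont G ->
  let x := circint (fun t => G t * phi k t) in
  let G' := fun t => G t - x / w * phi k t in
  cont G' /\
  (forall m, (k < m)%nat ->
     circint (fun t => G' t * phi m t) = circint (fun t => G t * phi m t)) /\
  w * circint (fun t => G' t ^ 2) = w * circint (fun t => G t ^ 2) - x ^ 2.
Proof.
  intros CG x G'. split; [unfold G'; regular|]. split.
  - intros m Hkm.
    rewrite (circint_ext _ (fun t => G t * phi m t - x / w * (phi k t * phi m t)))
      by (intros; unfold G'; ring).
    rewrite circint_minus, circint_scal, phi_orthogonal by regular. ring.
  - rewrite (circint_ext _ (fun t => G t ^ 2 - 2 * (x / w) * (G t * phi k t)
                                     + (x / w) ^ 2 * (phi k t * phi k t)))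
      by (intros; unfold G'; ring).
    rewrite circint_plus, circint_minus, !circint_scal, phi_norm by regular.
    fold x. field. lra.
Qed.

Lemma orthogonal_residual g n : cont g -> exists G, cont G /\
  (forall m, (n < m)%nat ->
     circint (fun t => G t * phi m t) = circint (fun t => g t * phi m t)) /\
  w * circint (fun t => G t ^ 2)
  = w * circint (fun t => g t ^ 2) - sum_n (fun k => circint (fun t => g t * phi k t) ^ 2) n.
Proof.
  intros Cg. induction n as [|n (G & CG & HG & Hnorm)].
  - destruct (orthogonal_projection 0 g Cg) as (CG & HG & Hnorm).
    eexists. split; [exact CG|]. rewrite sum_O. now split.
  - destruct (orthogonal_projection (S n) G CG) as (CG' & HG' & Hnorm').
    eexists. split; [exact CG'|]. split.
    + intros m Hm. rewrite HG' by lia. apply HG. lia.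
    + rewrite Hnorm', Hnorm, HG, sum_Sn by lia. unfold plus; simpl. ring.
Qed.

Lemma bessel g n : cont g ->
  sum_n (fun k => circint (fun t => g t * phi k t) ^ 2) n <= w * circint (fun t => g t ^ 2).
Proof.
  intros Cg. destruct (orthogonal_residual g n Cg) as (G & CG & _ & Hnorm).
  assert (HG : 0 <= circint (fun t => G t ^ 2)).
  { apply circint_ge0; [regular|]. intros; apply pow2_ge_0. }
  nra.
Qed.

Lemma orthogonal_coef_lim_0 g : cont g ->
  is_lim_seq (fun k => circint (fun t => g t * phi k t)) 0.
Proof.
  intros Cg. set (e := fun k => circint (fun t => g t * phi k t)).
  assert (Hsum : ex_series (fun k => e k ^ 2)).
  { destruct (ex_finite_lim_seq_incr (sum_n (fun k => e k ^ 2)) (w * circint (fun t => g t ^ 2)))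
      as [l Hl].
    - intros n. rewrite sum_Sn. unfold plus; simpl. generalize (pow2_ge_0 (e (S n))).
      simpl. lra.
    - intros n. now apply bessel.
    - now exists l. }
  apply ex_series_lim_0, (is_lim_seq_continuous sqrt) in Hsum;
    [|apply continuity_pt_sqrt; lra].
  rewrite sqrt_0 in Hsum. apply is_lim_seq_abs_0.
  apply is_lim_seq_ext with (2 := Hsum). intros n.
  now rewrite <- Rsqr_pow2, sqrt_Rsqr_abs.
Qed.

End OrthogonalSystem.

Definition dirichlet_kernel (n : nat) (u : R) : R :=
  / 2 + sum_n_m (fun k => cos (INR k * u)) 1 n.

Lemma dirichlet_kernel_0 u : dirichlet_kernel 0 u = / 2.
Proof. unfold dirichlet_kernel. rewrite sum_n_m_zero by lia. unfold zero; simpl. ring. Qed.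

Lemma dirichlet_kernel_S n u :
  dirichlet_kernel (S n) u = dirichlet_kernel n u + cos (INR (S n) * u).
Proof.
  unfold dirichlet_kernel. rewrite sum_n_Sm by lia. unfold plus; cbn -[INR]. ring.
Qed.

Lemma sin_half_dirichlet_kernel n u :
  2 * sin (u / 2) * dirichlet_kernel n u = sin ((INR n + / 2) * u).
Proof.
  induction n as [|n IH].
  - rewrite dirichlet_kernel_0. simpl (INR 0).
    replace ((0 + / 2) * u) with (u / 2) by field. field.
  - rewrite dirichlet_kernel_S, Rmult_plus_distr_l, IH, S_INR.
    replace ((INR n + / 2) * u) with ((INR n + 1) * u - u / 2) by field.
    replace ((INR n + 1 + / 2) * u) with ((INR n + 1) * u + u / 2) by field.
    rewrite sin_minus, sin_plus. ring.
Qed.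

Lemma cont_dirichlet_kernel n s : cont (fun t => dirichlet_kernel n (t - s)).
Proof.
  induction n as [|n IH]; intros t.
  - apply (continuous_ext (fun _ => / 2)); [intros; now rewrite dirichlet_kernel_0|].
    apply continuous_const.
  - apply (continuous_ext (fun t => dirichlet_kernel n (t - s) + cos (INR (S n) * (t - s)))).
    + intros; now rewrite dirichlet_kernel_S.
    + now apply cont_plus; [|apply cont_cos_shift].
Qed.

#[export] Hint Resolve cont_dirichlet_kernel : regularity.

Lemma circint_dirichlet_kernel n s : circint (fun t => dirichlet_kernel n (t - s)) = PI.
Proof.
  induction n as [|n IH].
  - rewrite (circint_ext _ (fun _ => / 2)) by (intros; apply dirichlet_kernel_0).
    rewrite circint_const. field.
  - rewrite (circint_ext _ _ (fun t => dirichlet_kernel_S n (t - s))).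
    rewrite circint_plus, IH, circint_cos_shift by (regular; lia). ring.
Qed.

Definition fourier_term (f : R -> R) (k : nat) : R -> R :=
  trig (INR k) (cos_coef f k) (sin_coef f k).

Definition fourier_sum (f : R -> R) (n : nat) (s : R) : R :=
  cos_coef f 0 / 2 + sum_n_m (fun k => fourier_term f k s) 1 n.

Lemma fourier_sum_0 f s : fourier_sum f 0 s = cos_coef f 0 / 2.
Proof. unfold fourier_sum. rewrite sum_n_m_zero by lia. unfold zero; simpl. ring. Qed.

Lemma fourier_sum_S f n s : fourier_sum f (S n) s = fourier_sum f n s + fourier_term f (S n) s.
Proof.
  unfold fourier_sum. rewrite sum_n_Sm by lia. unfold plus; cbn -[INR]. ring.
Qed.

Lemma admissible_fourier_sum f n : admissible (fourier_sum f n).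
Proof.
  induction n as [|n IH].
  - replace (fourier_sum f 0) with (fun _ : R => cos_coef f 0 / 2); [apply admissible_const|].
    apply functional_extensionality; intros s. now rewrite fourier_sum_0.
  - replace (fourier_sum f (S n)) with (fun s => fourier_sum f n s + fourier_term f (S n) s).
    + apply admissible_plus; [exact IH|apply admissible_trig].
    + apply functional_extensionality; intros s. now rewrite fourier_sum_S.
Qed.

#[export] Hint Resolve admissible_fourier_sum : regularity.

Lemma fourier_term_integral f k s : cont f ->
  PI * fourier_term f k s = circint (fun t => f t * cos (INR k * (t - s))).
Proof.
  intros Cf. rewrite (circint_ext _ _ (fun t => f_equal (Rmult (f t)) (cos_shiftE (INR k) s t))).
  rewrite circint_mult_trig by easy. unfold fourier_term, trig. ring.
Qed.

Lemma fourier_sum_integral f n s : cont f ->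
  PI * fourier_sum f n s = circint (fun t => f t * dirichlet_kernel n (t - s)).
Proof.
  intros Cf. assert (Hpi := PI_RGT_0). induction n as [|n IH].
  - rewrite (circint_ext _ (fun t => / 2 * f t))
      by (intros; rewrite dirichlet_kernel_0; ring).
    rewrite fourier_sum_0, cos_coef_0, circint_scal by easy. field. lra.
  - rewrite (circint_ext _ (fun t => f t * dirichlet_kernel n (t - s)
                                     + f t * cos (INR (S n) * (t - s))))
      by (intros; rewrite dirichlet_kernel_S; ring).
    rewrite circint_plus, fourier_sum_S, Rmult_plus_distr_l, IH by regular.
    now rewrite fourier_term_integral.
Qed.

Definition half_sine (s : R) (k : nat) (t : R) : R := sin ((INR k + / 2) * (t - s)).

Lemma sin_mult_sin x y : sin x * sin y = / 2 * (cos (x - y) - cos (x + y)).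
Proof. rewrite cos_minus, cos_plus; field. Qed.

Lemma half_sine_norm s k : circint (fun t => half_sine s k t * half_sine s k t) = PI.
Proof.
  rewrite (circint_ext _ (fun t => / 2 * (1 - cos (INR (2 * k + 1) * (t - s))))).
  - rewrite circint_scal, circint_minus, circint_const, circint_cos_shift
      by (regular; lia). field.
  - intros t. unfold half_sine. rewrite sin_mult_sin, Rminus_diag, cos_0, plus_INR, mult_INR.
    simpl INR. do 3 f_equal. field.
Qed.

Lemma half_sine_orthogonal s k m : (k < m)%nat ->
  circint (fun t => half_sine s k t * half_sine s m t) = 0.
Proof.
  intros Hkm.
  rewrite (circint_ext _ (fun t => / 2 * (cos (INR (m - k) * (t - s))
                                          - cos (INR (k + m + 1) * (t - s))))).
  - rewrite circint_scal, circint_minus, !circint_cos_shift by (regular; lia). ring.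
  - intros t. unfold half_sine. rewrite Rmult_comm, sin_mult_sin.
    rewrite minus_INR, !plus_INR by lia. simpl INR. do 2 f_equal; f_equal; field.
Qed.

Definition slope (f : R -> R) (s t : R) : R :=
  if Req_EM_T t s then Derive f s else (f t - f s) / (t - s).

Lemma slope_spec f s t : f t - f s = (t - s) * slope f s t.
Proof. unfold slope. destruct (Req_EM_T t s) as [->|Hts]; [ring|field; lra]. Qed.

Lemma cont_slope f s : cont f -> ex_derive f s -> cont (slope f s).
Proof.
  intros Cf Df t. destruct (Req_EM_T t s) as [->|Hts].
  - apply continuity_pt_filterlim. intros eps Heps.
    destruct (proj1 (is_derive_Reals _ _ _) (Derive_correct _ _ Df) eps Heps) as [d Hd].
    exists d. split; [apply cond_pos|]. intros x [[_ Hx] Hdist].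
    unfold slope. destruct (Req_EM_T s s) as [_|]; [|easy].
    destruct (Req_EM_T x s) as [|Hxs]; [congruence|].
    assert (Hxs' : x - s <> 0) by lra.
    rewrite <- (Rplus_minus s x) at 1. exact (Hd (x - s) Hxs' Hdist).
  - apply (continuous_ext_loc _ (fun u => (f u - f s) * / (u - s))).
    + apply (locally_open (fun u => u <> s)); [apply open_neq| |exact Hts].
      intros u Hus. unfold slope. now destruct (Req_EM_T u s).
    + apply (continuous_mult (K := R_AbsRing)).
      * now apply cont_minus; [|apply cont_const].
      * apply (ex_derive_continuous (V := R_NormedModule)). auto_derive. lra.
Qed.

Lemma sine_slope_neq0 s t : 0 < s < 2 * PI -> 0 <= t <= 2 * PI ->
  slope (fun u => 2 * sin ((u - s) / 2)) s t <> 0.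
Proof.
  intros Hs Ht. unfold slope. destruct (Req_EM_T t s) as [_|Hts].
  - replace (Derive _ s) with 1; [lra|]. symmetry. apply is_derive_unique. auto_derive; [easy|].
    replace ((s + - s) * / 2) with 0 by field. rewrite cos_0. field.
  - rewrite Rminus_diag. replace (0 / 2) with 0 by field. rewrite sin_0.
    apply Rmult_integral_contrapositive_currified; [|apply Rinv_neq_0_compat; lra].
    destruct (Rlt_le_dec s t).
    + assert (0 < sin ((t - s) / 2)) by (apply sin_gt_0; lra). lra.
    + assert (sin ((t - s) / 2) < 0) by (apply sin_lt_0_var; lra). lra.
Qed.

Lemma sine_quotient_exists f s : cont f -> ex_derive f s -> 0 < s < 2 * PI ->
  exists g, cont g /\
    forall t, 0 < t < 2 * PI -> f t - f s = 2 * sin ((t - s) / 2) * g t.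
Proof.
  intros Cf Df Hs. set (chord := fun u => 2 * sin ((u - s) / 2)).
  destruct (C0_extension_le (fun t => slope f s t * / slope chord s t) 0 (2 * PI))
    as (g & Cg & Hg).
  - intros t Ht.
    apply (continuous_mult (K := R_AbsRing) (slope f s) (fun t => / slope chord s t));
      [now apply cont_slope|].
    apply continuous_Rinv_comp; [|now apply sine_slope_neq0].
    apply cont_slope; [|unfold chord; auto_derive; easy].
    intros u. apply (ex_derive_continuous (V := R_NormedModule)).
    unfold chord; auto_derive; easy.
  - exists g. split; [exact Cg|]. intros t Ht.
    assert (Hchord : chord t = (t - s) * slope chord s t).
    { rewrite <- slope_spec. unfold chord. rewrite Rminus_diag.
      replace (0 / 2) with 0 by field. rewrite sin_0. ring. }
    rewrite Hg by lra. fold (chord t). rewrite Hchord, slope_spec. field.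
    apply sine_slope_neq0; lra.
Qed.

(* Chernoff's argument: dividing [f t - f s] by [2 sin ((t - s) / 2)] turns the remainder of
   the Fourier sum at [s] into the coefficients of a continuous function in an orthogonal
   system. *)
Lemma fourier_sum_lim_in f s : cont f -> ex_derive f s -> 0 < s < 2 * PI ->
  is_lim_seq (fun n => fourier_sum f n s) (f s).
Proof.
  intros Cf Df Hs. assert (Hpi := PI_RGT_0).
  destruct (sine_quotient_exists f s Cf Df Hs) as (g & Cg & Hg).
  assert (Hlim := orthogonal_coef_lim_0 (half_sine s) PI Hpi
    (fun k => cont_sin_shift _ s) (half_sine_norm s) (half_sine_orthogonal s) g Cg).
  apply is_lim_seq_ext with
    (fun n => f s + / PI * circint (fun t => g t * half_sine s n t)).
  - intros n. apply (Rmult_eq_reg_l PI); [|lra].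
    rewrite fourier_sum_integral by easy.
    rewrite Rmult_plus_distr_l, <- Rmult_assoc, Rinv_r, Rmult_1_l by lra.
    rewrite <- (circint_dirichlet_kernel n s) at 1.
    rewrite Rmult_comm, <- circint_scal, <- circint_plus
      by (unfold half_sine; regular).
    apply circint_ext_in. intros t Ht. unfold half_sine.
    rewrite <- sin_half_dirichlet_kernel.
    replace (f t) with (f s + 2 * sin ((t - s) / 2) * g t) by (rewrite <- Hg by easy; ring).
    ring.
  - replace (Finite (f s)) with (Rbar_plus (f s) (Rbar_mult (/ PI) 0)) by (simpl; f_equal; ring).
    apply is_lim_seq_plus'; [apply is_lim_seq_const|].
    apply (is_lim_seq_scal_l _ (/ PI) 0 Hlim).
Qed.

Lemma Derive2_trig w x y t :
  Derive (Derive (trig w x y)) t = - w ^ 2 * trig w x y t.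
Proof. rewrite !Derive_trig. unfold trig. ring. Qed.

Lemma circint_Derive2_trig f n x y : admissible f ->
  circint (fun t => Derive (Derive f) t * trig (INR n) x y t)
  = - INR n ^ 2 * circint (fun t => f t * trig (INR n) x y t).
Proof.
  intros Hf. rewrite circint_Derive_Derive by regular.
  rewrite <- circint_scal by regular.
  apply circint_ext. intros t. rewrite Derive2_trig. ring.
Qed.

Lemma Derive2_coef f n : admissible f ->
  cos_coef (Derive (Derive f)) n = - INR n ^ 2 * cos_coef f n /\
  sin_coef (Derive (Derive f)) n = - INR n ^ 2 * sin_coef f n.
Proof.
  intros Hf. apply coef_eq_of_pairing; regular.
  intros x y. now apply circint_Derive2_trig.
Qed.

Lemma fourier_term_bound f k s : cont f ->
  Rabs (fourier_term f k s) <= circint (fun t => Rabs (f t)) / PI.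
Proof.
  intros Cf. assert (Hpi := PI_RGT_0). apply (Rmult_le_reg_l PI); [easy|].
  rewrite <- (Rabs_pos_eq PI) at 1 by lra. rewrite <- Rabs_mult, fourier_term_integral by easy.
  replace (PI * (circint (fun t => Rabs (f t)) / PI)) with (circint (fun t => Rabs (f t)))
    by (field; lra).
  apply circint_abs_le; regular. intros t _. rewrite Rabs_mult.
  rewrite <- (Rmult_1_r (Rabs (f t))) at 2. apply Rmult_le_compat_l; [apply Rabs_pos|].
  apply Rabs_le, COS_bound.
Qed.

Definition fourier_rate (f : R -> R) : R :=
  circint (fun t => Rabs (Derive (Derive f) t)) / PI.

Lemma fourier_rate_ge0 f : admissible f -> 0 <= fourier_rate f.
Proof.
  intros Hf. apply Rmult_le_pos; [|apply Rlt_le, Rinv_0_lt_compat, PI_RGT_0].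
  apply circint_ge0; [regular|]. intros; apply Rabs_pos.
Qed.

Lemma fourier_term_decay f n s : admissible f ->
  Rabs (fourier_term f (S n) s) <= fourier_rate f / INR (S n) ^ 2.
Proof.
  intros Hf. assert (Hn : INR (S n) <> 0) by (apply not_0_INR; lia).
  assert (Hn2 := pow2_gt_0 _ Hn).
  apply (Rmult_le_reg_r (INR (S n) ^ 2)); [easy|].
  replace (fourier_rate f / INR (S n) ^ 2 * INR (S n) ^ 2) with (fourier_rate f)
    by (now field).
  rewrite <- (Rabs_pos_eq (INR (S n) ^ 2)) by lra. rewrite <- Rabs_mult, <- Rabs_Ropp.
  replace (- (fourier_term f (S n) s * INR (S n) ^ 2))
    with (fourier_term (Derive (Derive f)) (S n) s).
  - apply fourier_term_bound. regular.
  - unfold fourier_term. destruct (Derive2_coef f (S n) Hf) as [-> ->]. unfold trig. ring.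
Qed.

Lemma fourier_sum_cauchy f n j s : admissible f ->
  Rabs (fourier_sum f (j + S n) s - fourier_sum f (S n) s)
  <= fourier_rate f * (/ INR (S n) - / INR (j + S n)).
Proof.
  intros Hf. assert (HM := fourier_rate_ge0 f Hf).
  induction j as [|j IH].
  - rewrite !Rminus_diag, Rabs_R0. lra.
  - change (S j + S n)%nat with (S (j + S n)). rewrite fourier_sum_S.
    assert (Hm : 1 <= INR (j + S n)) by (apply (le_INR 1); lia).
    assert (Hdecay := fourier_term_decay f (j + S n) s Hf).
    set (m := (j + S n)%nat) in *.
    assert (Htelescope : / INR (S m) ^ 2 <= / INR m - / INR (S m)).
    { rewrite S_INR.
      replace (/ INR m - / (INR m + 1)) with (/ (INR m * (INR m + 1))) by (field; lra).
      apply Rinv_le_contravar; nra. }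
    apply (Rmult_le_compat_l _ _ _ HM) in Htelescope.
    assert (Htriangle := Rabs_triang (fourier_sum f m s - fourier_sum f (S n) s)
                           (fourier_term f (S m) s)).
    replace (fourier_sum f m s + fourier_term f (S m) s - fourier_sum f (S n) s)
      with (fourier_sum f m s - fourier_sum f (S n) s + fourier_term f (S m) s) by ring.
    unfold Rdiv in Hdecay. lra.
Qed.

Lemma fourier_sum_close f n s : admissible f ->
  Rabs (f s - fourier_sum f (S n) s) <= fourier_rate f / INR (S n).
Proof.
  intros Hf. revert s. apply periodic_le; [regular| |].
  { intros s. now rewrite !admissible_periodic by regular. }
  intros s Hs.
  assert (Hlim : is_lim_seq (fun j => Rabs (fourier_sum f (j + S n) s - fourier_sum f (S n) s))
                   (Rabs (f s - fourier_sum f (S n) s))).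
  { apply (is_lim_seq_abs _ (Finite _)), is_lim_seq_minus'; [|apply is_lim_seq_const].
    apply (is_lim_seq_incr_n (fun j => fourier_sum f j s)).
    apply fourier_sum_lim_in; auto using admissible_ex_derive; regular. }
  apply (is_lim_seq_le _ (fun _ => fourier_rate f / INR (S n)) _ (fourier_rate f / INR (S n)))
    with (2 := Hlim); [|apply is_lim_seq_const].
  intros j. apply Rle_trans with (1 := fourier_sum_cauchy f n j s Hf).
  apply Rmult_le_compat_l; [now apply fourier_rate_ge0|].
  assert (0 < / INR (j + S n)) by (apply Rinv_0_lt_compat, lt_0_INR; lia). lra.
Qed.

Lemma is_lim_seq_div_INR_S c : is_lim_seq (fun n => c / INR (S n)) 0.
Proof.
  replace (Finite 0) with (Rbar_mult c (Rbar_inv p_infty)) by (simpl; f_equal; ring).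
  apply is_lim_seq_scal_l, is_lim_seq_inv; [|easy].
  apply -> is_lim_seq_incr_1. apply is_lim_seq_INR.
Qed.

Lemma is_lim_seq_of_rate (u : nat -> R) (l C : R) :
  (forall n, Rabs (l - u (S n)) <= C / INR (S n)) -> is_lim_seq u l.
Proof.
  intros Hrate. assert (Hlim := is_lim_seq_div_INR_S C).
  apply is_lim_seq_incr_1, is_lim_seq_le_le
    with (fun n => l - C / INR (S n)) (fun n => l + C / INR (S n)).
  - intros n. generalize (proj1 (Rabs_le_between _ _) (Hrate n)). lra.
  - replace (Finite l) with (Finite (l - 0)) by (f_equal; ring).
    apply is_lim_seq_minus'; [apply is_lim_seq_const|exact Hlim].
  - replace (Finite l) with (Finite (l + 0)) by (f_equal; ring).
    apply is_lim_seq_plus'; [apply is_lim_seq_const|exact Hlim].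
Qed.

Lemma fourier_sum_lim f s : admissible f -> is_lim_seq (fun n => fourier_sum f n s) (f s).
Proof.
  intros Hf. apply is_lim_seq_of_rate with (fourier_rate f).
  intros n. now apply fourier_sum_close.
Qed.

Lemma circint_mult_fourier_sum_lim h f : cont h -> admissible f ->
  is_lim_seq (fun n => circint (fun t => h t * fourier_sum f n t)) (circint (fun t => h t * f t)).
Proof.
  intros Ch Hf.
  apply is_lim_seq_of_rate with (fourier_rate f * circint (fun t => Rabs (h t))). intros n.
  rewrite <- circint_minus by regular.
  replace (_ / INR (S n)) with (circint (fun t => fourier_rate f / INR (S n) * Rabs (h t)))
    by (rewrite circint_scal by regular; unfold Rdiv; ring).
  apply circint_abs_le; regular. intros t _.
  rewrite <- Rmult_minus_distr_l, Rabs_mult, Rmult_comm.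
  apply Rmult_le_compat_r; [apply Rabs_pos|now apply fourier_sum_close].
Qed.

Lemma circint_mult_ge0 h f : cont h -> admissible f ->
  (forall n, 0 <= cos_coef h n * cos_coef f n) ->
  (forall n, 0 <= sin_coef h n * sin_coef f n) ->
  0 <= circint (fun t => h t * f t).
Proof.
  intros Ch Hf Hc Hs. assert (Hpi := PI_RGT_0).
  apply (is_lim_seq_le (fun _ => 0) _ 0 _) with (2 := is_lim_seq_const 0)
    (3 := circint_mult_fourier_sum_lim h f Ch Hf).
  induction n as [|n IH].
  - rewrite (circint_ext _ (fun t => cos_coef f 0 / 2 * h t))
      by (intros; rewrite fourier_sum_0; ring).
    rewrite circint_scal by easy.
    replace (circint h) with (PI * cos_coef h 0) by (rewrite cos_coef_0; field; lra).
    generalize (Hc 0%nat). nra.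
  - rewrite (circint_ext _ (fun t => h t * fourier_sum f n t + h t * fourier_term f (S n) t))
      by (intros; rewrite fourier_sum_S; ring).
    unfold fourier_term.
    rewrite circint_plus, circint_mult_trig by regular.
    generalize (Hc (S n)) (Hs (S n)). nra.
Qed.

Definition vanishing_coef (f : R -> R) (n : nat) : Prop :=
  cos_coef f n = 0 /\ sin_coef f n = 0.

Lemma fourier_sum_eventually f m t : admissible f ->
  (forall n, (m < n)%nat -> vanishing_coef f n) -> f t = fourier_sum f m t.
Proof.
  intros Hf Hvanish.
  assert (Hstable : forall j, fourier_sum f (j + m) t = fourier_sum f m t).
  { induction j as [|j IH]; [easy|]. change (S j + m)%nat with (S (j + m)).
    rewrite fourier_sum_S, IH. unfold fourier_term.
    destruct (Hvanish (S (j + m))) as [-> ->]; [lia|]. unfold trig. ring. }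
  assert (Hlim := fourier_sum_lim f t Hf). apply (is_lim_seq_incr_n _ m) in Hlim.
  apply (is_lim_seq_ext _ _ _ Hstable), is_lim_seq_unique in Hlim.
  rewrite Lim_seq_const in Hlim. now injection Hlim.
Qed.

Lemma fourier_unique f t : admissible f -> (forall n, vanishing_coef f n) -> f t = 0.
Proof.
  intros Hf Hvanish. rewrite (fourier_sum_eventually f 0) by auto.
  rewrite fourier_sum_0, (proj1 (Hvanish 0%nat)). field.
Qed.

Lemma INR_sqr_inj m n : INR m ^ 2 = INR n ^ 2 -> m = n.
Proof.
  rewrite <- !Rsqr_pow2. intros Hmn. apply INR_eq, Rsqr_inj; auto using pos_INR.
Qed.

Lemma trig_coef_neq n k x y : n <> k -> vanishing_coef (trig (INR k) x y) n.
Proof.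
  intros Hnk. set (e := trig (INR k) x y).
  assert (Hne : INR n ^ 2 - INR k ^ 2 <> 0).
  { intros Heq. apply Hnk, INR_sqr_inj. lra. }
  assert (Horthogonal : forall x' y', circint (fun t => e t * trig (INR n) x' y' t) = 0).
  { intros x' y'.
    assert (Hparts := circint_Derive2_trig e n x' y' (admissible_trig k x y)).
    rewrite (circint_ext _ (fun t => - INR k ^ 2 * (e t * trig (INR n) x' y' t))) in Hparts
      by (intros; unfold e; rewrite Derive2_trig; ring).
    rewrite circint_scal in Hparts by (unfold e; regular).
    apply (Rmult_eq_reg_l (INR n ^ 2 - INR k ^ 2)); [lra|easy]. }
  destruct (coef_eq_of_pairing e e 0 n) as [Hc Hs]; try (unfold e; regular).
  - intros x' y'. rewrite Horthogonal. ring.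
  - rewrite Rmult_0_l in Hc, Hs. now split.
Qed.

Lemma cos2_sin2 t : cos t ^ 2 + sin t ^ 2 = 1.
Proof. rewrite <- !Rsqr_pow2, Rplus_comm. apply sin2_cos2. Qed.

Lemma trig_mult w x y x' y' t : trig w x y t * trig w x' y' t
  = (x * x' + y * y') / 2 + trig (2 * w) ((x * x' - y * y') / 2) ((x * y' + y * x') / 2) t.
Proof.
  unfold trig. rewrite Rmult_assoc, cos_2a, sin_2a.
  rewrite <- (Rmult_1_r ((x * x' + y * y') / 2)), <- (cos2_sin2 (w * t)). field.
Qed.

Lemma circint_trig_mult k x y x' y' : (1 <= k)%nat ->
  circint (fun t => trig (INR k) x y t * trig (INR k) x' y' t) = PI * (x * x' + y * y').
Proof.
  intros Hk.
  rewrite (circint_ext _ _ (trig_mult (INR k) x y x' y')).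
  replace (2 * INR k) with (INR (2 * k)) by (rewrite mult_INR; simpl; ring).
  rewrite circint_plus, circint_const, circint_trig by (regular; lia). field.
Qed.

Lemma trig_coef_self k x y : (1 <= k)%nat ->
  cos_coef (trig (INR k) x y) k = x /\ sin_coef (trig (INR k) x y) k = y.
Proof.
  intros Hk. assert (Hpi := PI_RGT_0).
  assert (Hpair : forall x' y', PI * (x' * cos_coef (trig (INR k) x y) k
    + y' * sin_coef (trig (INR k) x y) k) = PI * (x * x' + y * y')).
  { intros x' y'. rewrite <- circint_mult_trig by regular. now apply circint_trig_mult. }
  split; apply (Rmult_eq_reg_l PI); try lra;
    [generalize (Hpair 1 0)|generalize (Hpair 0 1)]; lra.
Qed.

Definition oscillator (m : R) (f : R -> R) (t : R) : R := Derive (Derive f) t + m * f t.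

Lemma admissible_oscillator m f : admissible f -> admissible (oscillator m f).
Proof. intros Hf. unfold oscillator. regular. Qed.

#[export] Hint Resolve admissible_oscillator : regularity.

Lemma oscillator_coef m f n : admissible f ->
  cos_coef (oscillator m f) n = (m - INR n ^ 2) * cos_coef f n /\
  sin_coef (oscillator m f) n = (m - INR n ^ 2) * sin_coef f n.
Proof.
  intros Hf. apply coef_eq_of_pairing; regular. intros x y.
  rewrite (circint_ext _ (fun t => Derive (Derive f) t * trig (INR n) x y t
    + m * (f t * trig (INR n) x y t))) by (intros; unfold oscillator; ring).
  rewrite circint_plus, circint_scal, circint_Derive2_trig by regular. ring.
Qed.

Lemma circint_oscillators_ge0 f m m' : admissible f ->
  (forall n : nat, 0 <= (m - INR n ^ 2) * (m' - INR n ^ 2)) ->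
  0 <= circint (fun t => oscillator m f t * oscillator m' f t).
Proof.
  intros Hf Hsymbol. apply circint_mult_ge0; regular; intros n;
    destruct (oscillator_coef m f n Hf) as [Ec Es];
    destruct (oscillator_coef m' f n Hf) as [Ec' Es'].
  - rewrite Ec, Ec'. generalize (Hsymbol n) (pow2_ge_0 (cos_coef f n)). nra.
  - rewrite Es, Es'. generalize (Hsymbol n) (pow2_ge_0 (sin_coef f n)). nra.
Qed.

Lemma oscillator_pairing_le f m m' : admissible f ->
  (forall n : nat, 0 <= (m - INR n ^ 2) * (m' - INR n ^ 2)) ->
  (m - m') * circint (fun t => oscillator m f t * f t)
  <= circint (fun t => oscillator m f t ^ 2).
Proof.
  intros Hf Hsymbol. assert (Hge0 := circint_oscillators_ge0 f m m' Hf Hsymbol).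
  rewrite (circint_ext _ (fun t => oscillator m f t ^ 2
    - (m - m') * (oscillator m f t * f t))) in Hge0 by (intros; unfold oscillator; ring).
  rewrite circint_minus, circint_scal in Hge0 by regular. lra.
Qed.

Lemma oscillator4_pairing_bounds f : admissible f ->
  - / 5 * circint (fun t => oscillator 4 f t ^ 2)
  <= circint (fun t => oscillator 4 f t * f t)
  <= / 3 * circint (fun t => oscillator 4 f t ^ 2).
Proof.
  intros Hf.
  assert (Hupper := oscillator_pairing_le f 4 1 Hf).
  assert (Hlower := oscillator_pairing_le f 4 9 Hf).
  split.
  - enough (-5 * circint (fun t => oscillator 4 f t * f t)
            <= circint (fun t => oscillator 4 f t ^ 2)) by lra.
    replace (-5) with (4 - 9) by ring. apply Hlower. intros [|[|[|n]]]; [simpl; lra..|].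
    assert (Hn : 3 <= INR (S (S (S n)))) by (rewrite !S_INR; generalize (pos_INR n); lra).
    assert (Hn2 : 9 <= INR (S (S (S n))) ^ 2) by nra. nra.
  - enough (3 * circint (fun t => oscillator 4 f t * f t)
            <= circint (fun t => oscillator 4 f t ^ 2)) by lra.
    replace 3 with (4 - 1) by ring. apply Hupper. intros [|[|n]]; [simpl; lra..|].
    assert (Hn : 2 <= INR (S (S n))) by (rewrite !S_INR; generalize (pos_INR n); lra).
    assert (Hn2 : 4 <= INR (S (S n)) ^ 2) by nra. nra.
Qed.

(** * Curves in the moving frame of the circle *)

Definition moving_frame (N T : R -> R) : curve :=
  fun t => (N t * cos t - T t * sin t, N t * sin t + T t * cos t).

Definition radial (g : curve) (t : R) : R := fst (g t) * cos t + snd (g t) * sin t.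
Definition angular (g : curve) (t : R) : R := snd (g t) * cos t - fst (g t) * sin t.

Lemma moving_frame_radial_angular g : moving_frame (radial g) (angular g) = g.
Proof.
  apply functional_extensionality; intros t. unfold moving_frame, radial, angular.
  assert (Htrig := cos2_sin2 t). destruct (g t) as [x y]; simpl in *.
  f_equal; [rewrite <- (Rmult_1_r x) at 3|rewrite <- (Rmult_1_r y) at 3];
    rewrite <- Htrig; ring.
Qed.

Lemma circle_moving_frame : circle = moving_frame (fun _ => 1) (fun _ => 0).
Proof.
  apply functional_extensionality; intros t. unfold circle, moving_frame. f_equal; ring.
Qed.

Lemma moving_frame_ext N N' T T' :
  (forall t, N t = N' t) -> (forall t, T t = T' t) -> moving_frame N T = moving_frame N' T'.
Proof. intros HN HT. now f_equal; apply functional_extensionality. Qed.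

Lemma det_moving_frame N T A B t :
  det (moving_frame N T t) (moving_frame A B t) = N t * B t - T t * A t.
Proof.
  unfold det, moving_frame; simpl.
  rewrite <- (Rmult_1_r (N t * B t - T t * A t)), <- (cos2_sin2 t). ring.
Qed.

Lemma smooth_curve_moving_frame N T : smooth N -> smooth T -> smooth_curve (moving_frame N T).
Proof. intros SN ST. unfold smooth_curve, moving_frame; simpl. split; regular. Qed.

Lemma periodic_moving_frame N T : periodic N -> periodic T -> periodic (moving_frame N T).
Proof.
  intros PN PT t. unfold moving_frame.
  now rewrite PN, PT, (admissible_periodic cos), (admissible_periodic sin) by regular.
Qed.

Lemma admissible_radial g : smooth_curve g -> periodic g -> admissible (radial g).
Proof.
  intros [Sx Sy] Pg. unfold radial.
  assert (Hx : admissible (fun t => fst (g t))) by (split; [easy|intros t; now rewrite Pg]).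
  assert (Hy : admissible (fun t => snd (g t))) by (split; [easy|intros t; now rewrite Pg]).
  regular.
Qed.

Lemma admissible_angular g : smooth_curve g -> periodic g -> admissible (angular g).
Proof.
  intros [Sx Sy] Pg. unfold angular.
  assert (Hx : admissible (fun t => fst (g t))) by (split; [easy|intros t; now rewrite Pg]).
  assert (Hy : admissible (fun t => snd (g t))) by (split; [easy|intros t; now rewrite Pg]).
  regular.
Qed.

Lemma Derive_const_plus c f t : Derive (fun s => c + f s) t = Derive f t.
Proof. unfold Derive. apply f_equal, Lim_ext. intros h. f_equal. ring. Qed.

Lemma Dcurve1_moving_frame N T : smooth N -> smooth T ->
  Dcurve 1 (moving_frame N T)
  = moving_frame (fun t => Derive N t - T t) (fun t => N t + Derive T t).
Proof.
  intros SN ST. apply functional_extensionality; intros t.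
  unfold Dcurve, moving_frame; f_equal; apply is_derive_unique; simpl.
  all: auto_derive; [repeat split; now apply smooth_ex_derive|].
  all: change (Derive (fun x => N x)) with (Derive N);
    change (Derive (fun x => T x)) with (Derive T); ring.
Qed.

Lemma Dcurve2_moving_frame N T : smooth N -> smooth T ->
  Dcurve 2 (moving_frame N T)
  = moving_frame (fun t => Derive (Derive N) t - 2 * Derive T t - N t)
                 (fun t => 2 * Derive N t + Derive (Derive T) t - T t).
Proof.
  intros SN ST.
  change (Dcurve 2 (moving_frame N T)) with (Dcurve 1 (Dcurve 1 (moving_frame N T))).
  rewrite !Dcurve1_moving_frame by regular.
  apply moving_frame_ext; intros t.
  - rewrite Derive_minus by (apply smooth_ex_derive; regular). ring.
  - rewrite Derive_plus by (apply smooth_ex_derive; regular). ring.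
Qed.

Lemma Dcurve1_circle : Dcurve 1 circle = moving_frame (fun _ => 0) (fun _ => 1).
Proof.
  rewrite circle_moving_frame, Dcurve1_moving_frame by regular.
  apply moving_frame_ext; intros t; rewrite Derive_const; ring.
Qed.

Lemma Dcurve2_circle : Dcurve 2 circle = moving_frame (fun _ => -1) (fun _ => 0).
Proof.
  rewrite circle_moving_frame, Dcurve2_moving_frame by regular.
  apply moving_frame_ext; intros t; rewrite !(Derive_ext _ _ _ (Derive_const _)), !Derive_const;
    ring.
Qed.

Lemma centroaffine_curvature_circle t : centroaffine_curvature circle t = 1.
Proof.
  unfold centroaffine_curvature. rewrite Dcurve1_circle, Dcurve2_circle, det_moving_frame.
  ring.
Qed.

Lemma cont_centroaffine_curvature g : smooth_curve g -> cont (centroaffine_curvature g).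
Proof.
  intros [Sx Sy].
  change (cont (fun t =>
    Derive (fun s => fst (g s)) t * Derive (Derive (fun s => snd (g s))) t
    - Derive (fun s => snd (g s)) t * Derive (Derive (fun s => fst (g s))) t)).
  regular.
Qed.

(** * The action of [SL(2)] *)

Definition linear_image (a b c d : R) (g : curve) : curve :=
  fun t => (a * fst (g t) + b * snd (g t), c * fst (g t) + d * snd (g t)).

Lemma det_linear_image a b c d g h s t :
  det (linear_image a b c d g s) (linear_image a b c d h t)
  = (a * d - b * c) * det (g s) (h t).
Proof. unfold det, linear_image; simpl. ring. Qed.

Lemma smooth_curve_Dcurve1 g : smooth_curve g -> smooth_curve (Dcurve 1 g).
Proof.
  intros [Sx Sy].
  split; [exact (smooth_Derive _ Sx)|exact (smooth_Derive _ Sy)].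
Qed.

Lemma Dcurve1_linear_image a b c d g : smooth_curve g ->
  Dcurve 1 (linear_image a b c d g) = linear_image a b c d (Dcurve 1 g).
Proof.
  intros [Sx Sy]. apply functional_extensionality; intros t.
  assert (Hlin : forall u v, Derive (fun s => u * fst (g s) + v * snd (g s)) t
    = u * Derive (fun s => fst (g s)) t + v * Derive (fun s => snd (g s)) t).
  { intros u v. rewrite Derive_plus, !Derive_scal by (apply smooth_ex_derive; regular).
    reflexivity. }
  exact (f_equal2 pair (Hlin a b) (Hlin c d)).
Qed.

Section SpecialLinear.
Variables (a b c d : R) (g : curve).
Hypothesis det1 : a * d - b * c = 1.
Hypothesis smooth_g : smooth_curve g.

Lemma centroaffine_curvature_linear_image t :
  centroaffine_curvature (linear_image a b c d g) t = centroaffine_curvature g t.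
Proof.
  unfold centroaffine_curvature.
  change (Dcurve 2 ?h) with (Dcurve 1 (Dcurve 1 h)).
  rewrite !Dcurve1_linear_image by auto using smooth_curve_Dcurve1.
  rewrite det_linear_image, det1. ring.
Qed.

Lemma curve_space_linear_image : curve_space g -> curve_space (linear_image a b c d g).
Proof.
  intros (_ & Pg & Wg & Pos). destruct smooth_g as [Sx Sy]. repeat split.
  - simpl. regular.
  - simpl. regular.
  - intros t. unfold linear_image. now rewrite Pg.
  - intros t. rewrite Dcurve1_linear_image, det_linear_image, det1, Wg by easy. ring.
  - intros t. rewrite centroaffine_curvature_linear_image. apply Pos.
Qed.

End SpecialLinear.

Lemma curve_space_normalization g : curve_space g -> exists h, curve_space h /\
  (forall t, centroaffine_curvature h t = centroaffine_curvature g t) /\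
  h 0 = circle 0 /\ Dcurve 1 h 0 = Dcurve 1 circle 0.
Proof.
  intros Hg. assert (Sg : smooth_curve g) by apply Hg.
  assert (W := proj1 (proj2 (proj2 Hg)) 0). unfold det in W.
  set (x := fst (g 0)) in *. set (y := snd (g 0)) in *.
  set (x' := fst (Dcurve 1 g 0)) in *. set (y' := snd (Dcurve 1 g 0)) in *.
  assert (det1 : y' * x - - x' * - y = 1) by lra.
  exists (linear_image y' (- x') (- y) x g). split; [now apply curve_space_linear_image|].
  split; [intros t; now apply centroaffine_curvature_linear_image|]. split.
  - unfold circle, linear_image. fold x y. rewrite cos_0, sin_0. f_equal; lra.
  - rewrite Dcurve1_linear_image, Dcurve1_circle by easy.
    unfold linear_image, moving_frame. fold x' y'. rewrite cos_0, sin_0. f_equal; lra.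
Qed.

(** * Curves close to the circle *)

(* The moving-frame coordinates of [g] and [g'] are [(1 + N, T)] and [(A, 1 + B)], and the
   equations are those of [g'' = - (1 + q) g]. *)
Record displacement (q N T A B : R -> R) : Prop := {
  displacement_admissible :
    admissible N /\ admissible T /\ admissible A /\ admissible B;
  displacement_Derive_N : forall t, Derive N t = A t + T t;
  displacement_Derive_T : forall t, Derive T t = B t - N t;
  displacement_Derive_A : forall t, Derive A t = B t - N t - q t * (1 + N t);
  displacement_Derive_B : forall t, Derive B t = - A t - T t - q t * T t;
  displacement_wronskian : forall t, N t + B t + N t * B t - T t * A t = 0;
  displacement_start : N 0 = 0 /\ T 0 = 0 /\ A 0 = 0 /\ B 0 = 0
}.

Lemma det_Dcurve2 g t : curve_space g -> det (g t) (Dcurve 2 g t) = 0.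
Proof.
  intros ([Sx Sy] & _ & W & _).
  set (x := fun s => fst (g s)) in *. set (y := fun s => snd (g s)) in *.
  assert (DW : Derive (fun s => x s * Derive y s - y s * Derive x s) t = 0).
  { rewrite (Derive_ext _ (fun _ => 1)) by exact W. apply Derive_const. }
  rewrite Derive_minus, !Derive_mult in DW by (apply smooth_ex_derive; regular).
  change (x t * Derive (Derive y) t - y t * Derive (Derive x) t = 0). lra.
Qed.

Lemma det_hill (u v w : R * R) : det u v = 1 -> det u w = 0 ->
  fst w = - det v w * fst u /\ snd w = - det v w * snd u.
Proof.
  unfold det. intros Huv Huw. split.
  - transitivity (fst w * (fst u * snd v - snd u * fst v)
                  - fst v * (fst u * snd w - snd u * fst w)); [|ring].
    rewrite Huv, Huw. ring.
  - transitivity (snd w * (fst u * snd v - snd u * fst v)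
                  - snd v * (fst u * snd w - snd u * fst w)); [|ring].
    rewrite Huv, Huw. ring.
Qed.

Lemma curve_space_moving_frame N T : admissible N -> admissible T ->
  let g := moving_frame (fun t => 1 + N t) T in
  let A := fun t => Derive N t - T t in
  let B := fun t => N t + Derive T t in
  curve_space g ->
  Dcurve 1 g = moving_frame A (fun t => 1 + B t) /\
  (forall t, (1 + N t) * (1 + B t) - T t * A t = 1) /\
  (forall t, Derive A t - (1 + B t) = - centroaffine_curvature g t * (1 + N t)) /\
  (forall t, A t + Derive B t = - centroaffine_curvature g t * T t).
Proof.
  intros HN HT g A B Hg.
  assert (Frame1 : Dcurve 1 g = moving_frame A (fun t => 1 + B t)).
  { unfold g. rewrite Dcurve1_moving_frame by regular.
    apply moving_frame_ext; intros t; rewrite ?Derive_const_plus; unfold A, B; ring. }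
  assert (Frame2 : Dcurve 2 g
    = moving_frame (fun t => Derive A t - (1 + B t)) (fun t => A t + Derive B t)).
  { change (Dcurve 2 g) with (Dcurve 1 (Dcurve 1 g)).
    rewrite Frame1, Dcurve1_moving_frame by (unfold A, B; regular).
    apply moving_frame_ext; intros t; rewrite ?Derive_const_plus; ring. }
  assert (Wronskian : forall t, (1 + N t) * (1 + B t) - T t * A t = 1).
  { intros t. assert (Wt := proj1 (proj2 (proj2 Hg)) t). rewrite Frame1 in Wt.
    unfold g in Wt. now rewrite det_moving_frame in Wt. }
  assert (Hill : forall t,
    Derive A t - (1 + B t) = - centroaffine_curvature g t * (1 + N t) /\
    A t + Derive B t = - centroaffine_curvature g t * T t).
  { intros t. unfold centroaffine_curvature. rewrite Frame1, Frame2, det_moving_frame.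
    apply (det_hill (1 + N t, T t) (A t, 1 + B t) (Derive A t - (1 + B t), A t + Derive B t)).
    - apply Wronskian.
    - assert (W2 := det_Dcurve2 g t Hg). rewrite Frame2 in W2.
      unfold g in W2. now rewrite det_moving_frame in W2. }
  split; [exact Frame1|]. split; [exact Wronskian|].
  split; intros t; apply Hill.
Qed.

Lemma curve_space_displacement g : curve_space g ->
  g 0 = circle 0 -> Dcurve 1 g 0 = Dcurve 1 circle 0 ->
  exists N T A B, displacement (fun t => centroaffine_curvature g t - 1) N T A B.
Proof.
  intros Hg Start Start'. set (N := fun t => radial g t - 1). set (T := angular g).
  assert (HN : admissible N).
  { apply admissible_minus; [apply admissible_radial; apply Hg|apply admissible_const]. }
  assert (HT : admissible T) by (apply admissible_angular; apply Hg).
  assert (Frame : g = moving_frame (fun t => 1 + N t) T).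
  { rewrite <- (moving_frame_radial_angular g) at 1.
    apply moving_frame_ext; intros t; unfold N, T; ring. }
  clearbody N T. subst g.
  destruct (curve_space_moving_frame N T HN HT Hg) as (Frame1 & Wronskian & HillA & HillB).
  set (A := fun t => Derive N t - T t) in *. set (B := fun t => N t + Derive T t) in *.
  exists N, T, A, B. split.
  - unfold A, B. split; [|split; [|split]]; regular.
  - intros t. unfold A. ring.
  - intros t. unfold B. ring.
  - intros t. generalize (HillA t). unfold B. lra.
  - intros t. generalize (HillB t). unfold A. lra.
  - intros t. generalize (Wronskian t). unfold A, B. lra.
  - rewrite Frame1, Dcurve1_circle in Start'.
    unfold moving_frame, circle in Start, Start'. rewrite cos_0, sin_0 in Start, Start'.
    injection Start as StartN StartT. injection Start' as StartA StartB.
    unfold A, B in *. repeat split; lra.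
Qed.

Lemma gronwall (E h : R -> R) c : 0 <= c -> (forall t, ex_derive E t) -> cont h ->
  (forall t, 0 <= h t) -> (forall t, Derive E t <= c * E t + h t) -> E 0 = 0 ->
  forall t, 0 <= t -> E t <= exp (c * t) * RInt h 0 t.
Proof.
  intros Hc DE Ch h_ge0 Hle E0 t Ht.
  set (F := fun s => exp (- c * s) * E s - RInt h 0 s).
  set (dF := fun s => exp (- c * s) * (Derive E s - c * E s) - h s).
  assert (HF : forall s, is_derive F s (dF s)).
  { intros s. apply (is_derive_minus (V := R_NormedModule)).
    - auto_derive; [apply DE|].
      change (Derive (fun x => E x)) with (Derive E). ring.
    - apply (is_derive_RInt (V := R_CompleteNormedModule)) with 0; [|apply Ch].
      apply filter_forall. intros u. apply RInt_correct. now apply cont_ex_RInt. }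
  assert (dF_le0 : forall s, 0 <= s -> dF s <= 0).
  { intros s Hs. unfold dF.
    assert (Hexp : 0 < exp (- c * s) <= 1).
    { split; [apply exp_pos|]. rewrite <- exp_0. apply Rnot_lt_le. intros Hlt.
      apply exp_lt_inv in Hlt. nra. }
    generalize (Hle s) (h_ge0 s). nra. }
  destruct (MVT_gen F 0 t dF) as (s & Hs & Hmvt).
  - intros s _. apply HF.
  - intros s _. apply continuity_pt_filterlim.
    apply (ex_derive_continuous (V := R_NormedModule)). eexists. apply HF.
  - rewrite Rmin_left, Rmax_right in Hs by easy.
    assert (F0 : F 0 = 0) by (unfold F; rewrite E0, RInt_point; unfold zero; simpl; ring).
    assert (Ft : exp (- c * t) * E t <= RInt h 0 t).
    { generalize (dF_le0 s (proj1 Hs)). unfold F in Hmvt, F0. nra. }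
    apply (Rmult_le_compat_l (exp (c * t))) in Ft; [|apply Rlt_le, exp_pos].
    rewrite <- Rmult_assoc, <- exp_plus in Ft.
    replace (c * t + - c * t) with 0 in Ft by ring. rewrite exp_0 in Ft. lra.
Qed.

Lemma RInt_le_circint h t : cont h -> (forall s, 0 <= h s) -> 0 <= t <= 2 * PI ->
  RInt h 0 t <= circint h.
Proof.
  intros Ch h_ge0 Ht. unfold circint.
  rewrite <- (RInt_Chasles h 0 t (2 * PI)) by now apply cont_ex_RInt.
  assert (Hrest : 0 <= RInt h t (2 * PI)) by (apply RInt_ge_0; [lra|now apply cont_ex_RInt|auto]).
  change (RInt h 0 t <= RInt h 0 t + RInt h t (2 * PI)). lra.
Qed.

Definition displacement_constant : R := 2 * PI * exp (4 * PI).

Lemma displacement_constant_pos : 0 < displacement_constant.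
Proof. apply Rmult_lt_0_compat; [apply twopi_pos|apply exp_pos]. Qed.

Lemma displacement_constant_ge1 : 1 <= displacement_constant.
Proof.
  unfold displacement_constant. assert (Hpi := PI2_1).
  generalize (exp_ineq1_le (4 * PI)). nra.
Qed.

Definition mean_error_constant : R :=
  1 + 2 * displacement_constant * (displacement_constant + 1) ^ 2
  + displacement_constant * (displacement_constant + 1).

Lemma mean_error_constant_pos : 0 < mean_error_constant.
Proof.
  assert (HC := displacement_constant_pos). unfold mean_error_constant.
  set (C := displacement_constant) in *. generalize (pow2_ge_0 (C + 1)). nra.
Qed.

Section Displacement.
Variables (q N T A B : R -> R) (delta : R).
Hypothesis displaced : displacement q N T A B.
Hypothesis q_cont : cont q.
Hypothesis delta_range : 0 < delta <= 1.
Hypothesis q_small : forall t, Rabs (q t) <= delta.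

Let q_norm2 : R := circint (fun t => q t ^ 2).
Let C : R := displacement_constant.
Let amplitude : R := sqrt (exp (4 * PI) * q_norm2).
Let residual (t : R) : R := 2 * (T t * A t - N t * B t) - q t * N t.

Let admissible_N : admissible N.
Proof. apply displaced. Qed.

Let admissible_T : admissible T.
Proof. apply displaced. Qed.

Let admissible_A : admissible A.
Proof. apply displaced. Qed.

Let admissible_B : admissible B.
Proof. apply displaced. Qed.

Lemma cont_residual : cont residual.
Proof. unfold residual. regular. Qed.

Lemma displacement_q_sqr_le t : q t ^ 2 <= delta ^ 2.
Proof. rewrite <- pow2_abs. apply pow_incr. split; [apply Rabs_pos|apply q_small]. Qed.

Lemma q_norm2_ge0 : 0 <= q_norm2.
Proof. apply circint_ge0; [regular|]. intros; apply pow2_ge_0. Qed.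

Lemma displacement_energy_Derive_le t :
  Derive (fun s => N s ^ 2 + T s ^ 2 + A s ^ 2 + B s ^ 2) t
  <= 2 * (N t ^ 2 + T t ^ 2 + A t ^ 2 + B t ^ 2) + q t ^ 2.
Proof.
  replace (Derive _ t)
    with (2 * (N t * Derive N t + T t * Derive T t + A t * Derive A t + B t * Derive B t)).
  - destruct displaced as [_ -> -> -> -> _ _].
    assert (Hq : q t ^ 2 <= 1) by (generalize (displacement_q_sqr_le t); nra).
    generalize (pow2_ge_0 (q t + A t)) (pow2_ge_0 (q t * N t + A t)) (pow2_ge_0 (q t * T t + B t)).
    nra.
  - symmetry. apply is_derive_unique. auto_derive.
    + repeat split; now apply admissible_ex_derive.
    + change (Derive (fun x => N x)) with (Derive N).
      change (Derive (fun x => T x)) with (Derive T).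
      change (Derive (fun x => A x)) with (Derive A).
      change (Derive (fun x => B x)) with (Derive B). ring.
Qed.

Lemma displacement_energy_le t : 0 <= t <= 2 * PI ->
  N t ^ 2 + T t ^ 2 + A t ^ 2 + B t ^ 2 <= amplitude ^ 2.
Proof.
  intros Ht. assert (Hnorm := q_norm2_ge0).
  unfold amplitude. rewrite pow2_sqrt by (apply Rmult_le_pos; [apply Rlt_le, exp_pos|easy]).
  apply Rle_trans with (exp (2 * t) * RInt (fun s => q s ^ 2) 0 t).
  - apply (gronwall (fun s => N s ^ 2 + T s ^ 2 + A s ^ 2 + B s ^ 2)); [lra| | | | | |easy].
    + intros s. auto_derive. repeat split; now apply admissible_ex_derive.
    + regular.
    + intros s. apply pow2_ge_0.
    + apply displacement_energy_Derive_le.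
    + destruct (displacement_start _ _ _ _ _ displaced) as (-> & -> & -> & ->). ring.
  - apply Rmult_le_compat; [apply Rlt_le, exp_pos| | |].
    + apply RInt_ge_0; [easy|apply cont_ex_RInt; regular|]. intros; apply pow2_ge_0.
    + apply Rnot_lt_le. intros Hlt. apply exp_lt_inv in Hlt. lra.
    + apply RInt_le_circint; [regular| |easy]. intros; apply pow2_ge_0.
Qed.

Lemma amplitude_ge0 : 0 <= amplitude.
Proof. apply sqrt_pos. Qed.

Lemma circint_amplitude_sqr : circint (fun _ => amplitude ^ 2) = C * q_norm2.
Proof.
  rewrite circint_const. unfold amplitude. rewrite pow2_sqrt.
  - unfold C, displacement_constant. ring.
  - apply Rmult_le_pos; [apply Rlt_le, exp_pos|apply q_norm2_ge0].
Qed.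

Lemma amplitude_le : amplitude <= C * delta.
Proof.
  assert (Hpi := twopi_pos). assert (HC := displacement_constant_ge1). fold C in HC.
  assert (Hnorm : q_norm2 <= 2 * PI * delta ^ 2).
  { rewrite <- circint_const. apply circint_le; [regular..|]. intros; apply displacement_q_sqr_le. }
  assert (Hamplitude := circint_amplitude_sqr). rewrite circint_const in Hamplitude.
  assert (Hamplitude_sqr : amplitude ^ 2 <= C * delta ^ 2).
  { apply (Rmult_le_reg_l (2 * PI)); [easy|]. rewrite Hamplitude. nra. }
  apply Rsqr_incr_0; [rewrite !Rsqr_pow2; nra|apply sqrt_pos|nra].
Qed.

Lemma displacement_N_le t : 0 <= t <= 2 * PI -> Rabs (N t) <= amplitude.
Proof.
  intros Ht. rewrite <- (Rabs_pos_eq amplitude) by apply amplitude_ge0.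
  apply Rsqr_le_abs_0. rewrite !Rsqr_pow2.
  generalize (displacement_energy_le t Ht) (pow2_ge_0 (T t)) (pow2_ge_0 (A t))
    (pow2_ge_0 (B t)). lra.
Qed.

Lemma displacement_residual_le t : 0 <= t <= 2 * PI ->
  Rabs (residual t) <= (C + 1) * delta * amplitude.
Proof.
  intros Ht. assert (Henergy := displacement_energy_le t Ht).
  assert (Hamplitude := amplitude_ge0). assert (Hamplitude_le := amplitude_le).
  assert (Hquadratic : Rabs (2 * (T t * A t - N t * B t)) <= amplitude ^ 2).
  { apply Rabs_le. generalize (pow2_ge_0 (T t + A t)) (pow2_ge_0 (T t - A t))
      (pow2_ge_0 (N t + B t)) (pow2_ge_0 (N t - B t)). split; nra. }
  assert (HqN : Rabs (q t * N t) <= delta * amplitude).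
  { rewrite Rabs_mult. apply Rmult_le_compat; auto using Rabs_pos, displacement_N_le. }
  unfold residual. eapply Rle_trans; [apply Rabs_triang|]. rewrite Rabs_Ropp. nra.
Qed.

Lemma displacement_oscillator t : oscillator 4 N t = residual t - q t.
Proof.
  destruct displaced as [_ DN DT DA _ W _]. unfold oscillator, residual.
  rewrite (Derive_ext _ _ _ DN), Derive_plus, DA, DT by now apply admissible_ex_derive.
  generalize (W t). lra.
Qed.

Lemma displacement_residual_pairing_le :
  Rabs (circint (fun t => residual t * N t)) <= C * (C + 1) * (delta * q_norm2).
Proof.
  replace (C * (C + 1) * (delta * q_norm2))
    with (circint (fun _ => (C + 1) * delta * amplitude ^ 2))
    by (rewrite circint_scal, circint_amplitude_sqr by regular; ring).
  apply circint_abs_le; [apply cont_mult; [apply cont_residual|regular]|regular|].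
  intros t Ht.
  replace ((C + 1) * delta * amplitude ^ 2) with ((C + 1) * delta * amplitude * amplitude)
    by ring.
  rewrite Rabs_mult. apply Rmult_le_compat; try apply Rabs_pos.
  - apply displacement_residual_le. lra.
  - apply displacement_N_le. lra.
Qed.

Lemma displacement_residual_norm2_le :
  circint (fun t => residual t ^ 2) <= C * (C + 1) ^ 2 * (delta ^ 2 * q_norm2).
Proof.
  replace (C * (C + 1) ^ 2 * (delta ^ 2 * q_norm2))
    with (circint (fun _ => (C + 1) ^ 2 * delta ^ 2 * amplitude ^ 2))
    by (rewrite circint_scal, circint_amplitude_sqr by regular; ring).
  apply circint_le; [apply cont_pow, cont_residual|regular|].
  intros t Ht. rewrite <- !Rpow_mult_distr, <- pow2_abs. apply pow_incr.
  split; [apply Rabs_pos|]. apply displacement_residual_le. lra.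
Qed.

Lemma displacement_oscillator_norm2_le :
  circint (fun t => oscillator 4 N t ^ 2)
  <= q_norm2 + (1 + 2 * C * (C + 1) ^ 2) * (delta * q_norm2).
Proof.
  assert (Cres := cont_residual). assert (Hres := displacement_residual_norm2_le).
  assert (Hinv : 0 < / delta) by (apply Rinv_0_lt_compat; lra).
  apply Rle_trans
    with (circint (fun t => (1 + delta) * q t ^ 2 + (1 + / delta) * residual t ^ 2)).
  - apply circint_le; [regular..|]. intros t _. rewrite displacement_oscillator.
    assert (Hsqr : 0 <= / delta * (delta * q t + residual t) ^ 2)
      by (apply Rmult_le_pos; [lra|apply pow2_ge_0]).
    replace (/ delta * (delta * q t + residual t) ^ 2)
      with (delta * q t ^ 2 + 2 * q t * residual t + / delta * residual t ^ 2) in Hsqr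
      by (field; lra).
    lra.
  - rewrite circint_plus, !circint_scal by regular. fold q_norm2.
    apply (Rmult_le_compat_l (1 + / delta)) in Hres; [|lra].
    replace ((1 + / delta) * (C * (C + 1) ^ 2 * (delta ^ 2 * q_norm2)))
      with (C * (C + 1) ^ 2 * (delta * q_norm2) * (delta + 1)) in Hres by (field; lra).
    assert (HC := displacement_constant_pos). fold C in HC.
    assert (Hpos : 0 <= C * (C + 1) ^ 2 * (delta * q_norm2)).
    { apply Rmult_le_pos; apply Rmult_le_pos; try lra; [apply pow2_ge_0|apply q_norm2_ge0]. }
    nra.
Qed.

Lemma displacement_mean :
  circint q = circint (fun t => oscillator 4 N t * N t) - circint (fun t => residual t * N t).
Proof.
  assert (Cres := cont_residual).
  assert (Hzero : circint (fun t => q t * (1 + N t)) = 0).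
  { destruct displaced as [_ DN DT DA _ _ _].
    rewrite (circint_ext _ (fun t => Derive T t - Derive A t))
      by (intros t; rewrite DT, DA; ring).
    rewrite circint_minus, !circint_Derive by regular. ring. }
  rewrite (circint_ext _ (fun t => q t - (oscillator 4 N t * N t - residual t * N t))) in Hzero
    by (intros t; rewrite displacement_oscillator; ring).
  rewrite !circint_minus in Hzero by regular. lra.
Qed.

Lemma displacement_mean_bounds :
  - (1 / 5 + mean_error_constant * delta) * q_norm2 <= circint q
  <= (1 / 3 + mean_error_constant * delta) * q_norm2.
Proof.
  destruct (oscillator4_pairing_bounds N admissible_N) as [Hlower Hupper].
  assert (Hosc := displacement_oscillator_norm2_le).
  assert (Hres := proj1 (Rabs_le_between _ _) displacement_residual_pairing_le).
  assert (HC := displacement_constant_pos). fold C in HC.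
  assert (Hpos : 0 <= delta * q_norm2) by (apply Rmult_le_pos; [lra|apply q_norm2_ge0]).
  assert (Hpos' : 0 <= (1 + 2 * C * (C + 1) ^ 2) * (delta * q_norm2)).
  { apply Rmult_le_pos; [nra|easy]. }
  rewrite displacement_mean. unfold mean_error_constant. fold C. split; lra.
Qed.

End Displacement.

Lemma mult_close x x0 y y0 d : Rabs (x - x0) < d -> Rabs (y - y0) < d ->
  Rabs x0 <= 1 -> Rabs y0 <= 1 -> d <= 1 -> Rabs (x * y - x0 * y0) <= 3 * d.
Proof.
  intros Hx Hy Hx0 Hy0 Hd.
  replace (x * y - x0 * y0) with ((x - x0) * (y - y0) + ((x - x0) * y0 + x0 * (y - y0))) by ring.
  eapply Rle_trans; [apply Rabs_triang|].
  assert (Htriangle := Rabs_triang ((x - x0) * y0) (x0 * (y - y0))).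
  rewrite !Rabs_mult in *.
  assert (0 <= Rabs (x - x0)) by apply Rabs_pos. assert (0 <= Rabs (y - y0)) by apply Rabs_pos.
  assert (Rabs (x - x0) * Rabs (y - y0) <= d) by nra.
  assert (Rabs (x - x0) * Rabs y0 <= d) by nra.
  assert (Rabs x0 * Rabs (y - y0) <= d) by nra. lra.
Qed.

Lemma det_close (u u0 v v0 : R * R) d :
  Rabs (fst u - fst u0) < d /\ Rabs (snd u - snd u0) < d ->
  Rabs (fst v - fst v0) < d /\ Rabs (snd v - snd v0) < d ->
  Rabs (fst u0) <= 1 /\ Rabs (snd u0) <= 1 -> Rabs (fst v0) <= 1 /\ Rabs (snd v0) <= 1 ->
  d <= 1 -> Rabs (det u v - det u0 v0) <= 6 * d.
Proof.
  intros [Hu1 Hu2] [Hv1 Hv2] [Hu01 Hu02] [Hv01 Hv02] Hd. unfold det.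
  assert (Hmain := mult_close _ _ _ _ d Hu1 Hv2 Hu01 Hv02 Hd).
  assert (Hcross := mult_close _ _ _ _ d Hu2 Hv1 Hu02 Hv01 Hd).
  apply Rabs_le_between in Hmain, Hcross. apply Rabs_le. lra.
Qed.

Lemma circle_derivatives_bounded t :
  (Rabs (fst (Dcurve 1 circle t)) <= 1 /\ Rabs (snd (Dcurve 1 circle t)) <= 1) /\
  (Rabs (fst (Dcurve 2 circle t)) <= 1 /\ Rabs (snd (Dcurve 2 circle t)) <= 1).
Proof.
  assert (Hcos := COS_bound t). assert (Hsin := SIN_bound t).
  rewrite Dcurve1_circle, Dcurve2_circle. unfold moving_frame; simpl.
  repeat split; apply Rabs_le; lra.
Qed.

Lemma curvature_close d g t : d <= 1 -> Cr_close 2 d circle g ->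
  Rabs (centroaffine_curvature g t - 1) <= 6 * d.
Proof.
  intros Hd Hclose. rewrite <- (centroaffine_curvature_circle t).
  destruct (circle_derivatives_bounded t) as [Hbound1 Hbound2].
  apply det_close; auto; apply Hclose; lia.
Qed.

Lemma curvature_mean_bounds g delta : 0 < delta <= 1 -> curve_space g ->
  (forall t, Rabs (centroaffine_curvature g t - 1) <= delta) ->
  let q := fun t => centroaffine_curvature g t - 1 in
  - (1 / 5 + mean_error_constant * delta) * circint (fun t => q t ^ 2) <= circint q
  <= (1 / 3 + mean_error_constant * delta) * circint (fun t => q t ^ 2).
Proof.
  intros Hdelta Hg Hsmall q.
  destruct (curve_space_normalization g Hg) as (h & Hh & Hcurv & Start & Start').
  destruct (curve_space_displacement h Hh Start Start') as (N & T & A & B & Hdispl).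
  replace (fun t => centroaffine_curvature h t - 1) with q in Hdispl
    by (apply functional_extensionality; intros t; unfold q; now rewrite Hcurv).
  apply displacement_mean_bounds with N T A B; trivial.
  unfold q. apply cont_minus; [apply cont_centroaffine_curvature, Hg|apply cont_const].
Qed.

(** * Second-order expansion of the functional *)

Lemma taylor2_peano (f df : R -> R) l r kappa :
  0 < r -> (forall x, Rabs x <= r -> is_derive f x (df x)) -> is_derive df 0 l -> 0 < kappa ->
  exists eta, 0 < eta <= r /\ forall x, Rabs x <= eta ->
    Rabs (f x - f 0 - df 0 * x - l / 2 * x ^ 2) <= kappa * x ^ 2.
Proof.
  intros Hr Df Ddf Hkappa.
  destruct (proj2 Ddf 0 (fun P HP => HP) (mkposreal kappa Hkappa)) as [d Hd].
  assert (Hdpos := cond_pos d).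
  exists (Rmin r (d / 2)). assert (Hl := Rmin_l r (d / 2)). assert (Hr' := Rmin_r r (d / 2)).
  split; [split; [apply Rmin_glb_lt|]; lra|]. intros x Hx.
  set (rest := fun y => f y - f 0 - df 0 * y - l / 2 * y ^ 2).
  assert (Hvar : Rabs (rest x - rest 0) <= kappa * Rabs x * Rabs (x - 0)).
  { apply (bounded_variation rest (fun y => df y - df 0 - l * y)). intros y Hy.
    rewrite !Rminus_0_r in Hy. split.
    - unfold rest. apply (is_derive_minus (V := R_NormedModule)
        (fun y => f y - f 0 - df 0 * y) (fun y => l / 2 * y ^ 2) y (df y - df 0) (l * y)).
      + assert (Dfy := Df y ltac:(lra)). auto_derive; [now exists (df y)|].
        change (Derive (fun x => f x)) with (Derive f).
        rewrite (is_derive_unique _ _ _ Dfy). ring.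
      + auto_derive; [easy|field].
    - assert (Hball : Rabs (y - 0) < d) by (rewrite Rminus_0_r; lra).
      assert (Hdy := Hd y Hball).
      change (Rabs (df y - df 0 - (y - 0) * l) <= kappa * Rabs (y - 0)) in Hdy.
      rewrite Rminus_0_r, (Rmult_comm y l) in Hdy. apply Rle_trans with (1 := Hdy).
      apply Rmult_le_compat_l; lra. }
  replace (rest x - rest 0) with (rest x) in Hvar by (unfold rest; ring).
  rewrite Rminus_0_r in Hvar. rewrite <- (pow2_abs x) at 2. unfold rest in Hvar. lra.
Qed.

Lemma is_derive_Rpower_1plus a x : -1 < x ->
  is_derive (fun y => Rpower (1 + y) a) x (a * Rpower (1 + x) (a - 1)).
Proof.
  intros Hx. replace (a * Rpower (1 + x) (a - 1)) with (1 * (a * Rpower (1 + x) (a - 1))) by ring.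
  apply (is_derive_comp (V := R_NormedModule) (fun y => Rpower y a) (fun y => 1 + y)).
  - apply is_derive_Reals, derivable_pt_lim_power. lra.
  - auto_derive; [easy|ring].
Qed.

Lemma Rpower_1_l a : Rpower 1 a = 1.
Proof. unfold Rpower. now rewrite ln_1, Rmult_0_r, exp_0. Qed.

Lemma Rpower_taylor2 a kappa : 0 < kappa -> exists eta, 0 < eta < 1 /\
  forall x, Rabs x <= eta ->
    Rabs (Rpower (1 + x) a - 1 - a * x - a * (a - 1) / 2 * x ^ 2) <= kappa * x ^ 2.
Proof.
  intros Hkappa.
  destruct (taylor2_peano (fun x => Rpower (1 + x) a) (fun x => a * Rpower (1 + x) (a - 1))
    (a * (a - 1)) (/ 2) kappa) as (eta & Heta & Htaylor); [lra| | |easy|].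
  - intros x Hx. apply is_derive_Rpower_1plus. apply Rabs_le_between in Hx. lra.
  - assert (D0 := is_derive_Rpower_1plus (a - 1) 0 ltac:(lra)).
    apply (is_derive_scal _ _ a) in D0. now rewrite Rplus_0_r, Rpower_1_l, Rmult_1_r in D0.
  - exists eta. split; [lra|]. intros x Hx. assert (Hx' := Htaylor x Hx).
    now rewrite Rplus_0_r, !Rpower_1_l, Rmult_1_r in Hx'.
Qed.

Lemma circint_Rpower_taylor2 a kappa : 0 < kappa -> exists eta, 0 < eta < 1 /\
  forall x, cont x -> (forall t, Rabs (x t) <= eta) ->
    Rabs (circint (fun t => Rpower (1 + x t) a) - 2 * PI - a * circint x
          - a * (a - 1) / 2 * circint (fun t => x t ^ 2))
    <= kappa * circint (fun t => x t ^ 2).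
Proof.
  intros Hkappa. destruct (Rpower_taylor2 a kappa Hkappa) as (eta & Heta & Htaylor).
  exists eta. split; [easy|]. intros x Cx Hx.
  assert (Cpower : cont (fun t => Rpower (1 + x t) a)).
  { apply cont_Rpower; [regular|]. intros t.
    generalize (proj1 (Rabs_le_between _ _) (Hx t)). lra. }
  replace (2 * PI) with (circint (fun _ => 1)) by (rewrite circint_const; ring).
  rewrite <- !circint_scal, <- !circint_minus by regular.
  apply circint_abs_le; [regular..|]. intros t _. apply Htaylor, Hx.
Qed.

(** * Local extrema *)

Lemma calB_circle a : calB a circle = 2 * PI.
Proof.
  change (circint (fun t => Rpower (centroaffine_curvature circle t) a) = 2 * PI).
  rewrite (circint_ext _ (fun _ => 1)), circint_const; [ring|].
  intros t. now rewrite centroaffine_curvature_circle, Rpower_1_l.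
Qed.

Lemma calB_expansion a kappa : 0 < kappa -> exists d, 0 < d /\ forall g,
  curve_space g -> Cr_close 2 d circle g ->
  exists mean norm2, 0 <= norm2 /\
    - (1 / 5 + kappa) * norm2 <= mean <= (1 / 3 + kappa) * norm2 /\
    Rabs (calB a g - 2 * PI - a * mean - a * (a - 1) / 2 * norm2) <= kappa * norm2.
Proof.
  intros Hkappa. destruct (circint_Rpower_taylor2 a kappa Hkappa) as (eta & Heta & Htaylor).
  assert (HM := mean_error_constant_pos). set (M := mean_error_constant) in *.
  set (delta := Rmin eta (kappa / M)).
  assert (Hdelta : 0 < delta) by (apply Rmin_glb_lt; [|apply Rdiv_lt_0_compat]; lra).
  assert (Hdelta_eta : delta <= eta) by apply Rmin_l.
  assert (HM_delta : M * delta <= kappa).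
  { replace kappa with (M * (kappa / M)) by (field; lra).
    apply Rmult_le_compat_l; [lra|apply Rmin_r]. }
  exists (delta / 6). split; [lra|]. intros g Hg Hclose.
  set (q := fun t => centroaffine_curvature g t - 1).
  assert (Cq : cont q).
  { apply cont_minus; [apply cont_centroaffine_curvature, Hg|apply cont_const]. }
  assert (Hq : forall t, Rabs (q t) <= delta).
  { intros t. replace delta with (6 * (delta / 6)) by field. apply curvature_close; [lra|easy]. }
  assert (Hnorm2 : 0 <= circint (fun t => q t ^ 2)).
  { apply circint_ge0; [regular|]. intros; apply pow2_ge_0. }
  exists (circint q), (circint (fun t => q t ^ 2)). split; [easy|]. split.
  - assert (Hmean := curvature_mean_bounds g delta ltac:(lra) Hg Hq). cbv zeta in Hmean.
    fold q M in Hmean. nra.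
  - replace (calB a g) with (circint (fun t => Rpower (1 + q t) a)).
    + apply Htaylor; [easy|]. intros t. generalize (Hq t). lra.
    + apply circint_ext. intros t. f_equal. unfold q. ring.
Qed.

(* The hypotheses say that [s (a x + a (a - 1) / 2)] is positive at both ends of the asymptotic
   range from [- 1 / 5] to [1 / 3] of the ratio [x] of the mean of [q] to its squared norm. *)
Lemma circle_signed_minimum s a :
  0 < s * (a / 3 + a * (a - 1) / 2) -> 0 < s * (- a / 5 + a * (a - 1) / 2) ->
  exists d, 0 < d /\ forall g, curve_space g -> Cr_close 2 d circle g ->
    s * calB a circle <= s * calB a g.
Proof.
  intros Hupper Hlower.
  set (gap := Rmin (s * (a / 3 + a * (a - 1) / 2)) (s * (- a / 5 + a * (a - 1) / 2))).
  assert (Hgap : 0 < gap) by now apply Rmin_glb_lt.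
  assert (Hgap_upper : gap <= s * (a / 3 + a * (a - 1) / 2)) by apply Rmin_l.
  assert (Hgap_lower : gap <= s * (- a / 5 + a * (a - 1) / 2)) by apply Rmin_r.
  set (slack := Rabs s * (1 + Rabs a) + 1).
  assert (Hslack : 1 <= slack) by (generalize (Rabs_pos s) (Rabs_pos a); unfold slack; nra).
  set (kappa := gap / slack).
  assert (Hkappa : 0 < kappa) by (apply Rdiv_lt_0_compat; lra).
  assert (Hkappa_gap : kappa * (Rabs s * (1 + Rabs a)) <= gap).
  { replace gap with (kappa * slack) by (unfold kappa; field; lra). unfold slack. nra. }
  destruct (calB_expansion a kappa Hkappa) as (d & Hd & Hexpansion).
  exists d. split; [easy|]. intros g Hg Hclose.
  destruct (Hexpansion g Hg Hclose) as (mean & norm2 & Hnorm2 & Hmean & HB).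
  assert (Hmain : (gap - kappa * (Rabs s * Rabs a)) * norm2
    <= s * a * mean + s * (a * (a - 1) / 2) * norm2).
  { rewrite <- Rabs_mult. destruct (Rle_dec 0 (s * a)) as [Hsa|Hsa].
    - rewrite Rabs_pos_eq by easy.
      assert (s * a * (- (1 / 5 + kappa) * norm2) <= s * a * mean)
        by (apply Rmult_le_compat_l; lra). nra.
    - rewrite Rabs_left by lra.
      assert (s * a * ((1 / 3 + kappa) * norm2) <= s * a * mean)
        by (apply Rmult_le_compat_neg_l; lra). nra. }
  apply (Rmult_le_compat_l (Rabs s)) in HB; [|apply Rabs_pos].
  rewrite <- Rabs_mult in HB. apply Rabs_le_between in HB. rewrite calB_circle. nra.
Qed.

Lemma circle_local_min a : a < 0 \/ 7 / 5 < a -> local_min (calB a) circle.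
Proof.
  intros Ha. destruct (circle_signed_minimum 1 a) as (d & Hd & Hmin); [nra..|].
  exists 2%nat, d. split; [easy|]. intros g Hg Hclose. generalize (Hmin g Hg Hclose). lra.
Qed.

Lemma circle_local_max a : 0 < a < 1 / 3 -> local_max (calB a) circle.
Proof.
  intros Ha. destruct (circle_signed_minimum (-1) a) as (d & Hd & Hmin); [nra..|].
  exists 2%nat, d. split; [easy|]. intros g Hg Hclose. generalize (Hmin g Hg Hclose). lra.
Qed.

(** * The Hessian *)

Definition linear_curvature (N T : R -> R) (t : R) : R :=
  2 * N t + 3 * Derive T t - Derive (Derive N) t.

Definition curvature_form (N1 T1 N2 T2 : R -> R) (t : R) : R :=
  (Derive N1 t - T1 t) * (2 * Derive N2 t + Derive (Derive T2) t - T2 t)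
  - (N1 t + Derive T1 t) * (Derive (Derive N2) t - 2 * Derive T2 t - N2 t).

Definition area_form (N T : R -> R) (t : R) : R :=
  N t * (N t + Derive T t) - T t * (Derive N t - T t).

Lemma admissible_linear_curvature N T :
  admissible N -> admissible T -> admissible (linear_curvature N T).
Proof. intros HN HT. unfold linear_curvature. regular. Qed.

Lemma admissible_curvature_form N1 T1 N2 T2 :
  admissible N1 -> admissible T1 -> admissible N2 -> admissible T2 ->
  admissible (curvature_form N1 T1 N2 T2).
Proof. intros HN1 HT1 HN2 HT2. unfold curvature_form. regular. Qed.

Lemma admissible_area_form N T : admissible N -> admissible T -> admissible (area_form N T).
Proof. intros HN HT. unfold area_form. regular. Qed.

#[export] Hint Resolve admissible_linear_curvature admissible_curvature_form
  admissible_area_form : regularity.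

Lemma centroaffine_curvature_moving_frame N T t : smooth N -> smooth T ->
  centroaffine_curvature (moving_frame (fun s => 1 + N s) T) t
  = 1 + linear_curvature N T t + curvature_form N T N T t.
Proof.
  intros SN ST. unfold centroaffine_curvature.
  rewrite Dcurve1_moving_frame, Dcurve2_moving_frame, det_moving_frame by regular.
  rewrite (Derive_ext _ _ _ (Derive_const_plus 1 N)), Derive_const_plus.
  unfold linear_curvature, curvature_form. ring.
Qed.

Lemma deformation_moving_frame N1 T1 N2 T2 eps :
  deformation (moving_frame N1 T1) (moving_frame N2 T2) eps
  = moving_frame (fun t => 1 + (eps * N1 t + eps ^ 2 * N2 t))
                 (fun t => eps * T1 t + eps ^ 2 * T2 t).
Proof.
  apply functional_extensionality; intros t.
  unfold deformation, add_curve, scale_curve, moving_frame, circle; cbn [fst snd].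
  f_equal; ring.
Qed.

Lemma Derive_lin c d f g : smooth f -> smooth g ->
  Derive (fun t => c * f t + d * g t) = fun t => c * Derive f t + d * Derive g t.
Proof.
  intros Sf Sg. apply functional_extensionality; intros t.
  rewrite Derive_plus, !Derive_scal by (apply smooth_ex_derive; regular). reflexivity.
Qed.

Lemma centroaffine_curvature_deformation N1 T1 N2 T2 eps t :
  smooth N1 -> smooth T1 -> smooth N2 -> smooth T2 ->
  centroaffine_curvature (deformation (moving_frame N1 T1) (moving_frame N2 T2) eps) t
  = 1 + (eps * linear_curvature N1 T1 t
         + eps ^ 2 * (linear_curvature N2 T2 t + curvature_form N1 T1 N1 T1 t)
         + eps ^ 3 * (curvature_form N1 T1 N2 T2 t + curvature_form N2 T2 N1 T1 t
                      + eps * curvature_form N2 T2 N2 T2 t)).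
Proof.
  intros SN1 ST1 SN2 ST2.
  rewrite deformation_moving_frame, centroaffine_curvature_moving_frame by regular.
  unfold linear_curvature, curvature_form. rewrite !Derive_lin by regular. ring.
Qed.

Lemma second_order_deformation_moving_frame N1 T1 N2 T2 :
  admissible N1 -> admissible T1 -> admissible N2 -> admissible T2 ->
  (second_order_deformation (moving_frame N1 T1) (moving_frame N2 T2) <->
   (forall t, 2 * N1 t + Derive T1 t = 0) /\
   (forall t, 2 * N2 t + Derive T2 t + area_form N1 T1 t = 0)).
Proof.
  intros [SN1 PN1] [ST1 PT1] [SN2 PN2] [ST2 PT2].
  unfold second_order_deformation.
  rewrite Dcurve1_circle, !Dcurve1_moving_frame, circle_moving_frame by easy.
  assert (Hsmooth1 := smooth_curve_moving_frame N1 T1 SN1 ST1).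
  assert (Hsmooth2 := smooth_curve_moving_frame N2 T2 SN2 ST2).
  assert (Hperiodic1 := periodic_moving_frame N1 T1 PN1 PT1).
  assert (Hperiodic2 := periodic_moving_frame N2 T2 PN2 PT2).
  split.
  - intros (_ & _ & _ & _ & Hfirst & Hsecond). split; intros t.
    + generalize (Hfirst t). rewrite !det_moving_frame. lra.
    + generalize (Hsecond t). rewrite !det_moving_frame. unfold area_form. lra.
  - intros [Hfirst Hsecond]. repeat (split; [assumption|]).
    split; intros t; rewrite !det_moving_frame.
    + generalize (Hfirst t). lra.
    + generalize (Hsecond t). unfold area_form. lra.
Qed.

Lemma is_eps2_coefficient_of_remainder (b : R -> R) c0 c1 q :
  (forall e, 0 < e -> exists d, 0 < d /\ forall eps, Rabs eps < d ->
     Rabs (b eps - c0 - c1 * eps - q * eps ^ 2) <= e * eps ^ 2) ->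
  is_eps2_coefficient b q.
Proof.
  intros Hb. exists c0, c1. apply is_lim_spec. intros e. assert (He := cond_pos e).
  destruct (Hb (e / 2)) as (d & Hd & Hrem); [lra|].
  exists (mkposreal d Hd). intros eps Hball Hne.
  assert (Heps : Rabs eps < d).
  { change (Rabs (eps - 0) < d) in Hball. now rewrite Rminus_0_r in Hball. }
  assert (Heps2 : 0 < eps ^ 2) by now apply pow2_gt_0.
  replace ((b eps - c0 - c1 * eps) / eps ^ 2 - q)
    with ((b eps - c0 - c1 * eps - q * eps ^ 2) / eps ^ 2) by (field; easy).
  rewrite Rabs_div, (Rabs_pos_eq (eps ^ 2)) by lra. apply Rlt_div_l; [easy|].
  generalize (Hrem eps Heps). nra.
Qed.

Section PowerPerturbation.
Variables (a bound : R) (P1 P2 : R -> R) (P3 : R -> R -> R).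
Hypothesis P1_cont : cont P1.
Hypothesis P2_cont : cont P2.
Hypothesis P3_cont : forall eps, cont (P3 eps).
Hypothesis bound_pos : 0 < bound.
Hypothesis P1_bounded : forall t, Rabs (P1 t) <= bound.
Hypothesis P2_bounded : forall t, Rabs (P2 t) <= bound.
Hypothesis P3_bounded : forall eps t, Rabs eps <= 1 -> Rabs (P3 eps t) <= bound.

Let perturbation (eps t : R) : R := eps * P1 t + eps ^ 2 * P2 t + eps ^ 3 * P3 eps t.

Let perturbation_cont eps : cont (perturbation eps).
Proof. unfold perturbation. regular. Qed.

Lemma perturbation_tail_le eps t : Rabs eps <= 1 ->
  Rabs (perturbation eps t - eps * P1 t) <= 2 * bound * Rabs eps ^ 2.
Proof.
  intros Heps. unfold perturbation.
  replace (_ - eps * P1 t) with (eps ^ 2 * (P2 t + eps * P3 eps t)) by ring.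
  rewrite Rabs_mult, <- RPow_abs.
  assert (Htriangle := Rabs_triang (P2 t) (eps * P3 eps t)). rewrite Rabs_mult in Htriangle.
  assert (Rabs eps * Rabs (P3 eps t) <= bound).
  { generalize (P3_bounded eps t Heps) (Rabs_pos eps) (Rabs_pos (P3 eps t)). nra. }
  generalize (P2_bounded t) (pow2_ge_0 (Rabs eps)). nra.
Qed.

Lemma perturbation_le eps t : Rabs eps <= 1 ->
  Rabs (perturbation eps t) <= 3 * bound * Rabs eps.
Proof.
  intros Heps. assert (Htail := perturbation_tail_le eps t Heps).
  assert (Htriangle := Rabs_triang (perturbation eps t - eps * P1 t) (eps * P1 t)).
  replace (perturbation eps t - eps * P1 t + eps * P1 t) with (perturbation eps t)
    in Htriangle by ring.
  rewrite Rabs_mult in Htriangle. assert (Heps0 := Rabs_pos eps).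
  assert (Rabs eps * Rabs (P1 t) <= Rabs eps * bound) by now apply Rmult_le_compat_l.
  assert (bound * Rabs eps ^ 2 <= bound * Rabs eps) by (apply Rmult_le_compat_l; nra).
  lra.
Qed.

Lemma perturbation_sqr_close eps t : Rabs eps <= 1 ->
  Rabs (perturbation eps t ^ 2 - eps ^ 2 * P1 t ^ 2) <= 8 * bound ^ 2 * Rabs eps ^ 3.
Proof.
  intros Heps. assert (Htail := perturbation_tail_le eps t Heps).
  assert (Hle := perturbation_le eps t Heps).
  replace (_ - _) with ((perturbation eps t - eps * P1 t) * (perturbation eps t + eps * P1 t))
    by ring.
  assert (Hsum : Rabs (perturbation eps t + eps * P1 t) <= 4 * bound * Rabs eps).
  { eapply Rle_trans; [apply Rabs_triang|]. rewrite Rabs_mult.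
    generalize (Rmult_le_compat_l _ _ _ (Rabs_pos eps) (P1_bounded t)). lra. }
  rewrite Rabs_mult.
  replace (8 * bound ^ 2 * Rabs eps ^ 3)
    with (2 * bound * Rabs eps ^ 2 * (4 * bound * Rabs eps)) by ring.
  apply Rmult_le_compat; auto using Rabs_pos.
Qed.

Lemma circint_perturbation_close eps : Rabs eps <= 1 ->
  Rabs (circint (perturbation eps) - eps * circint P1 - eps ^ 2 * circint P2)
  <= 2 * PI * (bound * Rabs eps ^ 3).
Proof.
  intros Heps.
  rewrite <- circint_const, <- !circint_scal, <- !circint_minus by regular.
  apply circint_abs_le; [regular..|]. intros t _. unfold perturbation.
  replace (_ - eps ^ 2 * P2 t) with (eps ^ 3 * P3 eps t) by ring.
  rewrite Rabs_mult, <- RPow_abs, Rmult_comm.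
  apply Rmult_le_compat_r; [apply pow_le, Rabs_pos|now apply P3_bounded].
Qed.

Lemma circint_perturbation_sqr_close eps : Rabs eps <= 1 ->
  Rabs (circint (fun t => perturbation eps t ^ 2) - eps ^ 2 * circint (fun t => P1 t ^ 2))
  <= 2 * PI * (8 * bound ^ 2 * Rabs eps ^ 3).
Proof.
  intros Heps. rewrite <- circint_const, <- circint_scal, <- circint_minus by regular.
  apply circint_abs_le; [regular..|]. intros t _. now apply perturbation_sqr_close.
Qed.

Lemma circint_perturbation_sqr_le eps : Rabs eps <= 1 ->
  circint (fun t => perturbation eps t ^ 2) <= 2 * PI * (9 * bound ^ 2 * Rabs eps ^ 2).
Proof.
  intros Heps. rewrite <- circint_const. apply circint_le; [regular..|]. intros t _.
  rewrite <- pow2_abs.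
  replace (9 * bound ^ 2 * Rabs eps ^ 2) with ((3 * bound * Rabs eps) ^ 2) by ring.
  apply pow_incr. split; [apply Rabs_pos|now apply perturbation_le].
Qed.

Let power_integral (eps : R) : R := circint (fun t => Rpower (1 + perturbation eps t) a).
Let coefficient : R := a * circint P2 + a * (a - 1) / 2 * circint (fun t => P1 t ^ 2).
Let cubic_constant : R := Rabs a * bound + Rabs (a * (a - 1) / 2) * (8 * bound ^ 2).

Lemma power_integral_remainder kappa : 0 < kappa -> exists d, 0 < d /\
  forall eps, Rabs eps < d ->
    Rabs (power_integral eps - 2 * PI - a * circint P1 * eps - coefficient * eps ^ 2)
    <= 2 * PI * (9 * bound ^ 2 * kappa + cubic_constant * Rabs eps) * eps ^ 2.
Proof.
  intros Hkappa. destruct (circint_Rpower_taylor2 a kappa Hkappa) as (eta & Heta & Htaylor).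
  exists (Rmin 1 (eta / (3 * bound))).
  split; [apply Rmin_glb_lt; [lra|apply Rdiv_lt_0_compat; lra]|].
  intros eps Hlt.
  assert (Heps : Rabs eps <= 1) by (generalize (Rmin_l 1 (eta / (3 * bound))); lra).
  assert (Heps_eta : 3 * bound * Rabs eps <= eta).
  { replace eta with (3 * bound * (eta / (3 * bound))) by (field; lra).
    apply Rmult_le_compat_l; [lra|]. generalize (Rmin_r 1 (eta / (3 * bound))); lra. }
  assert (Hpower := Htaylor (perturbation eps) (perturbation_cont eps)
    (fun t => Rle_trans _ _ _ (perturbation_le eps t Heps) Heps_eta)).
  fold (power_integral eps) in Hpower.
  assert (Hsqr_le := circint_perturbation_sqr_le eps Heps).
  apply (Rmult_le_compat_l kappa) in Hsqr_le; [|lra].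
  assert (Hmean := circint_perturbation_close eps Heps).
  apply (Rmult_le_compat_l (Rabs a)) in Hmean; [|apply Rabs_pos].
  rewrite <- Rabs_mult in Hmean.
  assert (Hsqr := circint_perturbation_sqr_close eps Heps).
  apply (Rmult_le_compat_l (Rabs (a * (a - 1) / 2))) in Hsqr; [|apply Rabs_pos].
  rewrite <- Rabs_mult in Hsqr.
  apply Rabs_le_between in Hpower, Hmean, Hsqr.
  rewrite <- (pow2_abs eps) at 2. apply Rabs_le. unfold coefficient, cubic_constant. lra.
Qed.

Lemma is_eps2_coefficient_power_integral : is_eps2_coefficient power_integral coefficient.
Proof.
  apply (is_eps2_coefficient_of_remainder _ (2 * PI) (a * circint P1)). intros e He.
  assert (Hpi := twopi_pos).
  set (quadratic := 2 * PI * (9 * bound ^ 2)). set (cubic := 2 * PI * cubic_constant + 1).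
  assert (Hquadratic : 0 < quadratic) by (apply Rmult_lt_0_compat; nra).
  assert (Hcubic : 0 < cubic).
  { assert (0 <= cubic_constant).
    { apply Rplus_le_le_0_compat; apply Rmult_le_pos; try apply Rabs_pos; nra. }
    unfold cubic. nra. }
  destruct (power_integral_remainder (e / 2 / quadratic)) as (d & Hd & Hrem);
    [repeat apply Rdiv_lt_0_compat; lra|].
  exists (Rmin d (e / 2 / cubic)).
  split; [apply Rmin_glb_lt; [easy|repeat apply Rdiv_lt_0_compat; lra]|]. intros eps Heps.
  assert (Heps_d : Rabs eps < d) by (generalize (Rmin_l d (e / 2 / cubic)); lra).
  assert (Heps_cubic : cubic * Rabs eps <= e / 2).
  { replace (e / 2) with (cubic * (e / 2 / cubic)) by (field; lra).
    apply Rmult_le_compat_l; [lra|]. generalize (Rmin_r d (e / 2 / cubic)); lra. }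
  apply Rle_trans with (1 := Hrem eps Heps_d).
  apply Rmult_le_compat_r; [apply pow2_ge_0|].
  assert (Hkappa : quadratic * (e / 2 / quadratic) = e / 2) by (field; lra).
  unfold quadratic, cubic in *. generalize (Rabs_pos eps). lra.
Qed.

End PowerPerturbation.

Lemma circint_linear_curvature N T : admissible N -> admissible T ->
  circint (linear_curvature N T) = circint (fun t => 2 * N t + Derive T t).
Proof.
  intros HN HT.
  rewrite (circint_ext _ (fun t => 2 * N t + Derive T t + 2 * Derive T t - Derive (Derive N) t))
    by (intros; unfold linear_curvature; ring).
  rewrite circint_minus, circint_plus, circint_scal, !circint_Derive by regular. ring.
Qed.

Lemma calB_deformation_coefficient a N1 T1 N2 T2 :
  admissible N1 -> admissible T1 -> admissible N2 -> admissible T2 ->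
  second_order_deformation (moving_frame N1 T1) (moving_frame N2 T2) ->
  is_eps2_coefficient
    (fun eps => calB a (deformation (moving_frame N1 T1) (moving_frame N2 T2) eps))
    (a * circint (fun t => curvature_form N1 T1 N1 T1 t - area_form N1 T1 t)
     + a * (a - 1) / 2 * circint (fun t => linear_curvature N1 T1 t ^ 2)).
Proof.
  intros HN1 HT1 HN2 HT2 Hdef.
  apply second_order_deformation_moving_frame in Hdef; trivial. destruct Hdef as [_ Hdef].
  set (P1 := linear_curvature N1 T1).
  set (P2 := fun t => linear_curvature N2 T2 t + curvature_form N1 T1 N1 T1 t).
  set (mixed := fun t => curvature_form N1 T1 N2 T2 t + curvature_form N2 T2 N1 T1 t).
  set (P4 := curvature_form N2 T2 N2 T2).
  assert (HP1 : admissible P1) by (unfold P1; regular).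
  assert (HP2 : admissible P2) by (unfold P2; regular).
  assert (Hmixed : admissible mixed) by (unfold mixed; regular).
  assert (HP4 : admissible P4) by (unfold P4; regular).
  replace (circint (fun t => _ - area_form N1 T1 t)) with (circint P2).
  - destruct (admissible_uniformly_bounded [P1; P2; mixed; P4]) as (B & HB & Hbound).
    { simpl. intros f. intuition congruence. }
    rewrite (functional_extensionality (fun eps => calB a _)
      (fun eps => circint (fun t => Rpower
        (1 + (eps * P1 t + eps ^ 2 * P2 t + eps ^ 3 * (mixed t + eps * P4 t))) a))).
    + apply (is_eps2_coefficient_power_integral a (2 * B) P1 P2
        (fun eps t => mixed t + eps * P4 t)); [regular..|lra| | |].
      * intros t. generalize (Hbound P1 t ltac:(simpl; tauto)). lra.
      * intros t. generalize (Hbound P2 t ltac:(simpl; tauto)). lra.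
      * intros eps t Heps. eapply Rle_trans; [apply Rabs_triang|]. rewrite Rabs_mult.
        generalize (Hbound mixed t ltac:(simpl; tauto)) (Hbound P4 t ltac:(simpl; tauto)).
        generalize (Rabs_pos eps) (Rabs_pos (P4 t)). nra.
    + intros eps. apply circint_ext. intros t. f_equal.
      apply centroaffine_curvature_deformation; regular.
  - unfold P2. rewrite circint_plus, circint_linear_curvature, circint_minus by regular.
    rewrite (circint_ext _ (fun t => - area_form N1 T1 t)) by (intros t; generalize (Hdef t); lra).
    rewrite circint_opp by regular. ring.
Qed.

Definition curvature_variation (f : R -> R) (t : R) : R :=
  Derive (Derive (Derive f)) t / 2 + 2 * Derive f t.

Definition hessian_polar (a : R) (f g : R -> R) : R :=
  circint (fun t =>
    a * (Derive f t * Derive g t - Derive (Derive f) t * Derive (Derive g) t / 4)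
    + a * (a - 1) / 2 * (curvature_variation f t * curvature_variation g t)).

Definition hessian (a : R) (f : R -> R) : R := hessian_polar a f f.

Lemma admissible_curvature_variation f : admissible f -> admissible (curvature_variation f).
Proof. intros Hf. unfold curvature_variation. regular. Qed.

#[export] Hint Resolve admissible_curvature_variation : regularity.

Definition radial_variation (f : R -> R) (t : R) : R := - (Derive f t / 2).

Lemma gamma1_moving_frame f : gamma1 f = moving_frame (radial_variation f) f.
Proof.
  apply functional_extensionality; intros t.
  unfold gamma1, add_curve, scale_curve, radial_variation.
  rewrite Dcurve1_circle. unfold circle, moving_frame; cbn [fst snd]. f_equal; ring.
Qed.

Section Variation.
Variable f : R -> R.
Hypothesis admissible_f : admissible f.

Lemma admissible_radial_variation : admissible (radial_variation f).
Proof. unfold radial_variation. regular. Qed.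

Lemma Derive_radial_variation t : Derive (radial_variation f) t = - (Derive (Derive f) t / 2).
Proof.
  unfold radial_variation. rewrite Derive_opp. unfold Rdiv.
  rewrite Derive_mult, Derive_const; [ring| |apply ex_derive_const].
  apply admissible_ex_derive. regular.
Qed.

Lemma Derive2_radial_variation t :
  Derive (Derive (radial_variation f)) t = - (Derive (Derive (Derive f)) t / 2).
Proof.
  rewrite (Derive_ext _ _ _ Derive_radial_variation), Derive_opp. unfold Rdiv.
  rewrite Derive_mult, Derive_const; [ring| |apply ex_derive_const].
  apply admissible_ex_derive. regular.
Qed.

Lemma linear_curvature_variation t :
  linear_curvature (radial_variation f) f t = curvature_variation f t.
Proof.
  unfold linear_curvature. rewrite Derive2_radial_variation.
  unfold radial_variation, curvature_variation. field.
Qed.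

Lemma circint_quadratic_variation :
  circint (fun t => curvature_form (radial_variation f) f (radial_variation f) f t
                    - area_form (radial_variation f) f t)
  = circint (fun t => Derive f t * Derive f t - Derive (Derive f) t * Derive (Derive f) t / 4).
Proof.
  rewrite (circint_ext _ (fun t => Derive f t * Derive f t
    + / 4 * (Derive (Derive (Derive f)) t * Derive f t))).
  - rewrite circint_plus, circint_scal, (circint_parts (Derive (Derive f))), circint_minus
      by regular.
    rewrite (circint_ext (fun t => _ / 4)
      (fun t => / 4 * (Derive (Derive f) t * Derive (Derive f) t))) by (intros; field).
    rewrite circint_scal by regular. ring.
  - intros t. unfold curvature_form, area_form.
    rewrite Derive2_radial_variation, Derive_radial_variation. unfold radial_variation. field.
Qed.

Lemma second_order_deformation_exists : exists g2, second_order_deformation (gamma1 f) g2.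
Proof.
  rewrite gamma1_moving_frame. assert (HN := admissible_radial_variation).
  exists (moving_frame (fun t => - (area_form (radial_variation f) f t / 2)) (fun _ => 0)).
  apply second_order_deformation_moving_frame; [regular..|].
  split; intros t; [unfold radial_variation|rewrite Derive_const]; field.
Qed.

Lemma hessian_coefficient a g2 : second_order_deformation (gamma1 f) g2 ->
  is_eps2_coefficient (fun eps => calB a (deformation (gamma1 f) g2 eps)) (hessian a f).
Proof.
  intros Hdef. assert (Hg2 := Hdef). destruct Hg2 as (_ & _ & Sg2 & Pg2 & _).
  rewrite gamma1_moving_frame, <- (moving_frame_radial_angular g2) in Hdef |- *.
  assert (HN := admissible_radial_variation).
  replace (hessian a f) with
    (a * circint (fun t => curvature_form (radial_variation f) f (radial_variation f) f t
                           - area_form (radial_variation f) f t)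
     + a * (a - 1) / 2 * circint (fun t => linear_curvature (radial_variation f) f t ^ 2)).
  - apply calB_deformation_coefficient; auto using admissible_radial, admissible_angular.
  - rewrite circint_quadratic_variation, <- !circint_scal, <- circint_plus by regular.
    apply circint_ext. intros t. rewrite linear_curvature_variation. ring.
Qed.

End Variation.

Lemma is_hessian_hessian a : is_hessian a (hessian a).
Proof.
  intros f Hf. split; [now apply second_order_deformation_exists|].
  intros g2. now apply hessian_coefficient.
Qed.

Definition hessian_operator (a : R) (f : R -> R) (t : R) : R :=
  - a * (Derive (Derive f) t + Derive (Derive (Derive (Derive f))) t / 4)
  - a * (a - 1) / 2 * curvature_variation (curvature_variation f) t.

Lemma admissible_hessian_operator a f : admissible f -> admissible (hessian_operator a f).
Proof. intros Hf. unfold hessian_operator. regular. Qed.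

#[export] Hint Resolve admissible_hessian_operator : regularity.

Lemma circint_curvature_variation f g : admissible f -> admissible g ->
  circint (fun t => curvature_variation f t * g t)
  = - circint (fun t => f t * curvature_variation g t).
Proof.
  intros Hf Hg.
  rewrite (circint_ext _ (fun t => / 2 * (Derive (Derive (Derive f)) t * g t)
    + 2 * (Derive f t * g t))) by (intros; unfold curvature_variation; field).
  rewrite (circint_ext (fun t => f t * _) (fun t => / 2 * (f t * Derive (Derive (Derive g)) t)
    + 2 * (f t * Derive g t))) by (intros; unfold curvature_variation; field).
  rewrite !circint_plus, !circint_scal by regular.
  rewrite (circint_Derive_Derive (Derive f)), !(circint_parts f) by regular. ring.
Qed.

Lemma hessian_polar_operator a f g : admissible f -> admissible g ->
  hessian_polar a f g = circint (fun t => f t * hessian_operator a g t).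
Proof.
  intros Hf Hg. unfold hessian_polar.
  rewrite (circint_ext _ (fun t => a * (Derive f t * Derive g t)
    - a / 4 * (Derive (Derive f) t * Derive (Derive g) t)
    + a * (a - 1) / 2 * (curvature_variation f t * curvature_variation g t)))
    by (intros; field).
  rewrite (circint_ext (fun t => f t * _) (fun t => - a * (f t * Derive (Derive g) t)
    - a / 4 * (f t * Derive (Derive (Derive (Derive g))) t)
    - a * (a - 1) / 2 * (f t * curvature_variation (curvature_variation g) t)))
    by (intros; unfold hessian_operator; field).
  rewrite circint_plus, !circint_minus, !circint_scal by regular.
  rewrite (circint_parts f), (circint_Derive_Derive f), circint_curvature_variation by regular.
  ring.
Qed.

Lemma hessian_polar_sym a f g : hessian_polar a f g = hessian_polar a g f.
Proof. apply circint_ext. intros t. field. Qed.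

Lemma hessian_polarization a f g : admissible f -> admissible g ->
  hessian a (fun t => f t + g t) - hessian a f - hessian a g = 2 * hessian_polar a f g.
Proof.
  intros Hf Hg. unfold hessian, hessian_polar.
  rewrite <- circint_scal, <- !circint_minus by regular. apply circint_ext. intros t.
  unfold curvature_variation. rewrite !Derive_plus_fun
    by (intros; apply admissible_ex_derive; regular). field.
Qed.

Definition hessian_eigenvalue (a : R) (n : nat) : R :=
  a * INR n ^ 2 * (INR n ^ 2 - 4) / 8 * ((a - 1) * (INR n ^ 2 - 4) - 2).

Lemma curvature_variation_trig w x y :
  curvature_variation (trig w x y)
  = trig w ((2 * w - w ^ 3 / 2) * y) (- (2 * w - w ^ 3 / 2) * x).
Proof.
  apply functional_extensionality; intros t. unfold curvature_variation.
  rewrite !Derive_trig. unfold trig. field.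
Qed.

Lemma hessian_operator_trig a n x y t :
  hessian_operator a (trig (INR n) x y) t = hessian_eigenvalue a n * trig (INR n) x y t.
Proof.
  unfold hessian_operator, hessian_eigenvalue.
  rewrite !curvature_variation_trig, !Derive_trig. unfold trig. field.
Qed.

Lemma hessian_polar_trig a f n x y : admissible f ->
  hessian_polar a f (trig (INR n) x y)
  = hessian_eigenvalue a n * circint (fun t => f t * trig (INR n) x y t).
Proof.
  intros Hf. rewrite hessian_polar_operator, <- circint_scal by regular.
  apply circint_ext. intros t. rewrite hessian_operator_trig. ring.
Qed.

Lemma hessian_operator_coef a f n : admissible f ->
  cos_coef (hessian_operator a f) n = hessian_eigenvalue a n * cos_coef f n /\
  sin_coef (hessian_operator a f) n = hessian_eigenvalue a n * sin_coef f n.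
Proof.
  intros Hf. apply coef_eq_of_pairing; [regular..|]. intros x y.
  rewrite <- hessian_polar_trig, hessian_polar_sym, hessian_polar_operator by regular.
  apply circint_ext. intros t. ring.
Qed.

Lemma hessian_trig a n x y : (1 <= n)%nat ->
  hessian a (trig (INR n) x y) = hessian_eigenvalue a n * (PI * (x * x + y * y)).
Proof.
  intros Hn. unfold hessian. rewrite hessian_polar_trig by regular.
  now rewrite circint_trig_mult.
Qed.

Lemma in_kernel_hessianE a f : admissible f ->
  (in_kernel (hessian a) f <-> forall n, hessian_eigenvalue a n = 0 \/ vanishing_coef f n).
Proof.
  intros Hf. split.
  - intros [_ Hker] n. destruct (Req_dec (hessian_eigenvalue a n) 0) as [|Hn]; [now left|right].
    assert (Horthogonal : forall x y, circint (fun t => f t * trig (INR n) x y t) = 0).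
    { intros x y. assert (Hxy := Hker (trig (INR n) x y) (admissible_trig n x y)).
      rewrite hessian_polarization, hessian_polar_trig in Hxy by regular.
      apply (Rmult_eq_reg_l (hessian_eigenvalue a n)); lra. }
    assert (Hcoef := coef_eq_of_pairing f f 0 n). rewrite !Rmult_0_l in Hcoef.
    apply Hcoef; [regular..|]. intros x y. rewrite Horthogonal. ring.
  - intros Hspectrum. split; [easy|]. intros g Hg.
    rewrite hessian_polarization, hessian_polar_sym, hessian_polar_operator by easy.
    rewrite (circint_ext _ (fun _ => 0)), circint_const; [ring|]. intros t.
    rewrite (fourier_unique (hessian_operator a f)); [ring|regular|]. intros n.
    unfold vanishing_coef. destruct (hessian_operator_coef a f n Hf) as [-> ->].
    destruct (Hspectrum n) as [->|[-> ->]]; split; ring.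
Qed.

(** * Trivial deformations and the kernel *)

Lemma coef_minus f g n : cont f -> cont g ->
  cos_coef (fun t => f t - g t) n = cos_coef f n - cos_coef g n /\
  sin_coef (fun t => f t - g t) n = sin_coef f n - sin_coef g n.
Proof.
  intros Cf Cg. assert (Hpi := PI_RGT_0).
  assert (Hpair : forall x y,
    PI * (x * cos_coef (fun t => f t - g t) n + y * sin_coef (fun t => f t - g t) n)
    = PI * (x * cos_coef f n + y * sin_coef f n) - PI * (x * cos_coef g n + y * sin_coef g n)).
  { intros x y. rewrite <- !circint_mult_trig, <- circint_minus by regular.
    apply circint_ext. intros t. ring. }
  split; apply (Rmult_eq_reg_l PI); try lra;
    [generalize (Hpair 1 0)|generalize (Hpair 0 1)]; lra.
Qed.

Lemma trivial_deformation_coef f : admissible f ->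
  (trivial_deformation f <-> forall n, n <> 0%nat -> n <> 2%nat -> vanishing_coef f n).
Proof.
  intros Hf. split.
  - intros (c0 & c1 & c2 & Hc) n Hn0 Hn2.
    destruct (trig_coef_neq n 0 (- c0) 0 Hn0) as [Hcos0 Hsin0].
    destruct (trig_coef_neq n 2 c1 c2 Hn2) as [Hcos2 Hsin2].
    replace f with (fun t => trig (INR 2) c1 c2 t - trig (INR 0) (- c0) 0 t).
    + unfold vanishing_coef. destruct (coef_minus (trig (INR 2) c1 c2) (trig (INR 0) (- c0) 0) n)
        as [-> ->]; [regular..|]. split; lra.
    + apply functional_extensionality; intros t. rewrite Hc. unfold trig. simpl (INR 0).
      rewrite Rmult_0_l, cos_0. replace (INR 2) with 2 by (simpl; ring). ring.
  - intros Hvanish. exists (cos_coef f 0 / 2), (cos_coef f 2), (sin_coef f 2). intros t.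
    rewrite (fourier_sum_eventually f 2) by (try intros; try apply Hvanish; trivial; lia).
    rewrite !fourier_sum_S, fourier_sum_0. unfold fourier_term.
    destruct (Hvanish 1%nat) as [-> ->]; [lia..|]. unfold trig.
    replace (INR 2) with 2 by (simpl; ring). ring.
Qed.

Lemma trivial_deformation_minus_trig f k x y :
  admissible f -> k <> 0%nat -> k <> 2%nat ->
  (trivial_deformation (fun t => f t - trig (INR k) x y t) <->
   (cos_coef f k = x /\ sin_coef f k = y) /\
   forall n, n <> 0%nat -> n <> 2%nat -> n <> k -> vanishing_coef f n).
Proof.
  intros Hf Hk0 Hk2. rewrite trivial_deformation_coef by regular.
  assert (Hcoef := fun n => coef_minus f (trig (INR k) x y) n ltac:(regular) ltac:(regular)).
  unfold vanishing_coef in *. destruct (trig_coef_self k x y ltac:(lia)) as [Ex Ey]. split.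
  - intros Hvanish. split.
    + destruct (Hvanish k Hk0 Hk2), (Hcoef k). split; lra.
    + intros n Hn0 Hn2 Hnk. destruct (trig_coef_neq n k x y Hnk).
      destruct (Hvanish n Hn0 Hn2), (Hcoef n). split; lra.
  - intros [[Hx Hy] Hvanish] n Hn0 Hn2. destruct (Hcoef n) as [-> ->].
    destruct (Nat.eq_dec n k) as [->|Hnk]; [split; lra|].
    destruct (Hvanish n Hn0 Hn2 Hnk), (trig_coef_neq n k x y Hnk). split; lra.
Qed.

Lemma trig_nontrivial k x y : k <> 0%nat -> k <> 2%nat -> x <> 0 ->
  ~ trivial_deformation (trig (INR k) x y).
Proof.
  intros Hk0 Hk2 Hx Htrivial. rewrite trivial_deformation_coef in Htrivial by regular.
  apply Hx. rewrite <- (proj1 (trig_coef_self k x y ltac:(lia))).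
  exact (proj1 (Htrivial k Hk0 Hk2)).
Qed.

Lemma INR_sqr_neq4 n : n <> 2%nat -> INR n ^ 2 - 4 <> 0.
Proof.
  intros Hn Heq. apply Hn, INR_sqr_inj. replace (INR 2) with 2 by (simpl; ring). lra.
Qed.

Lemma hessian_eigenvalue_eq0 a n : a <> 0 -> n <> 0%nat -> n <> 2%nat ->
  (hessian_eigenvalue a n = 0 <-> a = (INR n ^ 2 - 2) / (INR n ^ 2 - 4)).
Proof.
  intros Ha Hn0 Hn2. assert (Hn4 := INR_sqr_neq4 n Hn2).
  assert (Hn : INR n <> 0) by now apply not_0_INR.
  unfold hessian_eigenvalue. split.
  - intros Hzero. apply Rmult_integral in Hzero. destruct Hzero as [Hzero|Hzero].
    + exfalso. revert Hzero. repeat apply Rmult_integral_contrapositive_currified; lra.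
    + apply (Rmult_eq_reg_r (INR n ^ 2 - 4)); [|easy]. field_simplify; lra.
  - intros ->. now field.
Qed.

Lemma degenerate_exponent_inj k n : k <> 2%nat -> n <> 2%nat ->
  (INR k ^ 2 - 2) / (INR k ^ 2 - 4) = (INR n ^ 2 - 2) / (INR n ^ 2 - 4) -> n = k.
Proof.
  intros Hk Hn Heq. apply INR_sqr_neq4 in Hk, Hn.
  assert (Hshift : forall z, z - 4 <> 0 -> (z - 2) / (z - 4) = 1 + 2 * / (z - 4))
    by (intros; now field).
  rewrite !Hshift in Heq by easy.
  apply INR_sqr_inj. assert (Hinv : / (INR k ^ 2 - 4) = / (INR n ^ 2 - 4)) by lra.
  apply Rinv_eq_reg in Hinv. lra.
Qed.

Lemma hessian_cosine k a : k <> 0%nat -> k <> 2%nat ->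
  exists f, admissible f /\ ~ trivial_deformation f /\
    hessian a f = hessian_eigenvalue a k * PI.
Proof.
  intros Hk0 Hk2. exists (trig (INR k) 1 0). split; [regular|].
  split; [now apply trig_nontrivial; [..|lra]|].
  rewrite hessian_trig by lia. ring.
Qed.

Lemma hessian_not_sign_definite a : 1 / 3 <= a <= 7 / 5 -> ~ sign_definite (hessian a).
Proof.
  intros Ha. assert (Hpi := PI_RGT_0). intros [Hpos|Hneg].
  - destruct (hessian_cosine 3 a) as (f & Hf & Hnontrivial & Heigen); [lia..|].
    assert (Hf_pos := Hpos f Hf Hnontrivial). rewrite Heigen in Hf_pos.
    unfold hessian_eigenvalue in Hf_pos. replace (INR 3) with 3 in Hf_pos by (simpl; ring).
    assert (0 <= a * (7 - 5 * a)) by nra. nra.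
  - destruct (hessian_cosine 1 a) as (f & Hf & Hnontrivial & Heigen); [lia..|].
    assert (Hf_neg := Hneg f Hf Hnontrivial). rewrite Heigen in Hf_neg.
    unfold hessian_eigenvalue in Hf_neg. simpl (INR 1) in Hf_neg.
    assert (0 <= a * (3 * a - 1)) by nra. nra.
Qed.

Lemma hessian_degenerate_iff a : a <> 0 ->
  (degenerate (hessian a) <->
   exists k : nat, (0 < k)%nat /\ k <> 2%nat /\ a = (INR k ^ 2 - 2) / (INR k ^ 2 - 4)).
Proof.
  intros Ha. split.
  - intros (f & Hker & Hnontrivial). assert (Hf : admissible f) by apply Hker.
    apply NNPP. intros Hnone. apply Hnontrivial, trivial_deformation_coef; [easy|].
    intros n Hn0 Hn2.
    destruct (proj1 (in_kernel_hessianE a f Hf) Hker n) as [Hzero|]; [exfalso|easy].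
    apply Hnone. exists n. apply hessian_eigenvalue_eq0 in Hzero; trivial.
    repeat split; [lia|easy..].
  - intros (k & Hk & Hk2 & Hak). exists (trig (INR k) 1 0). split.
    + apply in_kernel_hessianE; [regular|]. intros n.
      destruct (Nat.eq_dec n k) as [->|Hnk]; [left|right; now apply trig_coef_neq].
      apply hessian_eigenvalue_eq0; trivial. lia.
    + apply trig_nontrivial; lia || lra.
Qed.

Lemma times_i_trig k : times_i (trig (INR k) 1 0) (trig (INR k) 0 (-1)).
Proof.
  intros n Hn. destruct (Nat.eq_dec n k) as [->|Hnk].
  - destruct (trig_coef_self k 1 0 Hn) as [-> ->], (trig_coef_self k 0 (-1) Hn) as [-> ->].
    split; ring.
  - destruct (trig_coef_neq n k 1 0 Hnk) as [-> ->], (trig_coef_neq n k 0 (-1) Hnk) as [-> ->].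
    split; ring.
Qed.

Lemma in_kernel_hessian_minus_trig a k f : a <> 0 -> k <> 0%nat -> k <> 2%nat ->
  a = (INR k ^ 2 - 2) / (INR k ^ 2 - 4) -> admissible f ->
  (in_kernel (hessian a) f <->
   exists x y, trivial_deformation (fun t => f t - trig (INR k) x y t)).
Proof.
  intros Ha Hk0 Hk2 Hak Hf. rewrite in_kernel_hessianE by easy. split.
  - intros Hspectrum. exists (cos_coef f k), (sin_coef f k).
    apply trivial_deformation_minus_trig; trivial. split; [easy|]. intros n Hn0 Hn2 Hnk.
    destruct (Hspectrum n) as [Hzero|]; [exfalso|easy].
    apply hessian_eigenvalue_eq0 in Hzero; trivial.
    apply Hnk, degenerate_exponent_inj; trivial. congruence.
  - intros (x & y & Htrivial) n.
    apply trivial_deformation_minus_trig in Htrivial as [_ Hvanish]; trivial.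
    destruct (Nat.eq_dec n 0) as [->|Hn0]; [left; unfold hessian_eigenvalue; simpl; field|].
    destruct (Nat.eq_dec n 2) as [->|Hn2]; [left; unfold hessian_eigenvalue; simpl; field|].
    destruct (Nat.eq_dec n k) as [->|Hnk]; [left; now apply hessian_eigenvalue_eq0|].
    right. now apply Hvanish.
Qed.

Lemma hessian_one_dimensional_kernel a k : a <> 0 -> k <> 0%nat -> k <> 2%nat ->
  a = (INR k ^ 2 - 2) / (INR k ^ 2 - 4) -> one_dimensional_kernel (hessian a).
Proof.
  intros Ha Hk0 Hk2 Hak.
  exists (trig (INR k) 1 0), (trig (INR k) 0 (-1)).
  split; [regular|]. split; [apply trig_nontrivial; lia || lra|].
  split; [regular|]. split; [apply times_i_trig|].
  intros f Hf. rewrite (in_kernel_hessian_minus_trig a k f) by easy.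
  assert (Hcombination : forall x y,
    (fun t => f t - (x * trig (INR k) 1 0 t + y * trig (INR k) 0 (-1) t))
    = fun t => f t - trig (INR k) x (- y) t).
  { intros x y. apply functional_extensionality; intros t. unfold trig. ring. }
  split; intros (x & y & Htrivial); exists x, (- y).
  - now rewrite Hcombination, Ropp_involutive.
  - now rewrite Hcombination in Htrivial.
Qed.

Theorem theorem2 (a : R) (ha : a <> 0) :
  (a < 0 -> local_min (calB a) circle) /\
  (0 < a < 1 / 3 -> local_max (calB a) circle) /\
  (7 / 5 < a -> local_min (calB a) circle) /\
  exists Q : (R -> R) -> R,
    is_hessian a Q /\
    (~ (a < 0 \/ 0 < a < 1 / 3 \/ 7 / 5 < a) -> ~ sign_definite Q) /\
    (degenerate Q <->
     exists k : nat, (0 < k)%nat /\ k <> 2%nat /\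
       a = (INR k ^ 2 - 2) / (INR k ^ 2 - 4)) /\
    (degenerate Q -> one_dimensional_kernel Q).
Proof.
  split; [intros Ha; apply circle_local_min; now left|].
  split; [apply circle_local_max|].
  split; [intros Ha; apply circle_local_min; now right|].
  exists (hessian a). split; [apply is_hessian_hessian|]. split; [|split].
  - intros Hcase. apply hessian_not_sign_definite. lra.
  - now apply hessian_degenerate_iff.
  - intros Hdeg. apply hessian_degenerate_iff in Hdeg as (k & Hk & Hk2 & Hak); [|easy].
    apply (hessian_one_dimensional_kernel a k); trivial. lia.
Qed.
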